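(* Let $f:\mathcal{X}\to\mathcal{X}$ be a dynamical system with an ergodic $f$-invariant probability measure $\mu$, let $Y\subset\mathcal{X}$ be measurable with $\mu(Y)>0$, let $F_Y:Y\to Y$ be the first return map to $Y$, and let $\mu_Y$ be the conditional measure on $Y$. Let $\varphi$ be an observable and $(u_n)_n$ levels as described in the context, with $U(u_n)=\{\varphi>u_n\}\subset Y$ for all sufficiently large $n$. Let $N_n$ and $N_n^Y$ be the rare event point processes of the original and of the induced system respectively, and let $N$ be a point process on $[0,\infty)$. Assume that for every $J\in\mathcal{R}$, $N(J^\eta)$ is continuous in $\eta$ for all small $\eta$, in the following sense: if $J=\bigcup_{j=1}^\ell I_j$ with $I_1,\dots,I_\ell\in\mathcal{S}$, then there is $\eta_0>0$ such that for every $k_1,\dots,k_\ell\in\mathbb{N}$ the map $$\eta\mapsto \mathbb{P}\big(N(I_1^\eta)\ge k_1,\dots,N(I_\ell^\eta)\ge k_\ell\big)$$ is continuous on $[0,\eta_0)$, where $\mathbb{P}$ denotes the probability governing $N$. Then $$N_n^Y\stackrel{\mu_Y}{\Longrightarrow}N\ \text{ as } n\to\infty\quad\text{implies}\quad N_n\stackrel{\mu}{\Longrightarrow}N\ \text{ as } n\to\infty.$$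
   Context: Observable and levels: $\mathcal{X}$ is a metric space and $\varphi:\mathcal{X}\to\mathbb{R}\cup\{+\infty\}$ is a function of the distance to a point $\zeta\in\mathcal{X}$, attaining its unique maximum $u_\varphi$ (possibly $+\infty$) at $\zeta$, continuous and strictly decreasing (hence invertible) as a function of that distance near $\zeta$, so that for $u<u_\varphi$ close to $u_\varphi$ the set $U(u)=\{\varphi>u\}$ is a ball around $\zeta$. Put $X_i=\varphi\circ f^i$, $i\ge0$. The levels $(u_n)_n$ satisfy $\lim_{n\to\infty}n\,\mu(X_0>u_n)=\tau$ for some $\tau>0$. Inducing: $r_Y(x)=\inf\{n\ge1: f^n(x)\in Y\}$ is the first return time, $F_Y=f^{r_Y}$ is the first return map (defined $\mu$-a.e. on $Y$), and $\mu_Y(\cdot)=\mu(\cdot\cap Y)/\mu(Y)$, which is $F_Y$-invariant. Put $X_i^Y=\varphi\circ F_Y^i$ on $Y$. Intervals: $\mathcal{S}$ is the semi-ring of intervals $[a,b)$ with $a,b\in[0,\infty)$, and $\mathcal{R}$ is the ring generated by $\mathcal{S}$, so that every $J\in\mathcal{R}$ is a finite union of elements of $\mathcal{S}$. For $v>0$, $vJ=\{vt:t\in J\}$. For $\eta>0$ and $I\in\mathcal{S}$, $I^\eta=\bigcup_{s\in I}\big((s-\eta,s+\eta)\cap[0,\infty)\big)$, and $I^0=I$. For $J=\bigcup_{j=1}^\ell I_j$, $J^\eta=\bigcup_{j=1}^\ell I_j^\eta$. Rare event point processes: with $v_n=1/\mu(X_0>u_n)$ and $v_n^Y=1/\mu_Y(X_0>u_n)$,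 for $J\in\mathcal{R}$ let $$N_n(J)=\sum_{j\in v_nJ\cap\mathbb{N}_0}\mathbf{1}_{\{X_j>u_n\}},\qquad N_n^Y(J)=\sum_{j\in v_n^YJ\cap\mathbb{N}_0}\mathbf{1}_{\{X^Y_j>u_n\}},$$ where $\mathbb{N}_0=\{0,1,2,\dots\}$. They are regarded as random counting measures on $[0,\infty)$, defined on $\mathcal{X}$ and on $Y$ respectively. Convergence: $\mathcal{M}_p([0,\infty))$ is the space of counting measures on $[0,\infty)$ with the vague topology ($\nu_n\to\nu$ iff $\nu_n(\psi)\to\nu(\psi)$ for all continuous compactly supported $\psi$). A point process is a random element of $\mathcal{M}_p([0,\infty))$. For a probability measure $m$, $N_n\stackrel{m}{\Longrightarrow}N$ means that the law of $N_n$ under $m$ converges weakly to the law of $N$. *)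

(* Defs.v *)
From HB Require Import structures.
From mathcomp Require Import all_boot all_order all_algebra.
From mathcomp Require Import all_classical all_reals all_analysis.
From mathcomp Require Import measurable_realfun.

Set Implicit Arguments.
Unset Strict Implicit.
Unset Printing Implicit Defensive.

Import Order.TTheory GRing.Theory Num.Theory.
Import numFieldNormedType.Exports.

Local Open Scope classical_set_scope.
Local Open Scope ring_scope.

(* A type carrying both a distance and a sigma-algebra.  No compatibility is
   built in: that the sigma-algebra is the Borel one is a separate hypothesis. *)
#[short(type="measurableMetricType")]
HB.structure Definition MeasurableMetric (d : measure_display)
  (R : numDomainType) := { T of Metric R T & Measurable d T }.

Section Dynamics.
Local Open Scope ereal_scope.
Context {d : measure_display} {T : measurableType d} {R : realType}.

Definition invariant_measure (mu : set T -> \bar R) (f : T -> T) : Prop :=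
  forall A, measurable A -> mu (f @^-1` A) = mu A.

Definition ergodic (mu : set T -> \bar R) (f : T -> T) : Prop :=
  forall A, measurable A -> f @^-1` A = A -> mu A = 0 \/ mu A = 1.

(* The infimum of an empty set of return times is infinite; it is encoded by 0,
   so that the first return map below is then the identity.  For an invariant
   probability measure this only concerns a null subset of Y. *)
Definition first_return_time (f : T -> T) (Y : set T) (x : T) : nat :=
  match pselect (exists n, (0 < n)%N && `[< Y (iter n f x) >]) with
  | left h => ex_minn h
  | right _ => 0%N
  end.

Definition first_return_map (f : T -> T) (Y : set T) (x : T) : T :=
  iter (first_return_time f Y x) f x.

(* The induced measure is kept as a probability on the whole space. *)
Definition induced_measure (mu : probability T R) (Y : set T)
    (mY : measurable Y) : probability T R :=
  mnormalize (mrestr mu mY) mu.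

Lemma induced_measureE (mu : probability T R) (Y : set T) (mY : measurable Y) :
  0 < mu Y -> forall A, induced_measure mu mY A = mu (A `&` Y) / mu Y.
Proof.
move=> Y0 A; have Yfin : mu Y \is a fin_num by exact: fin_num_measure.
have Yoo : mu Y != +oo by move: Yfin; rewrite fin_numE => /andP[].
rewrite /induced_measure /= /mnormalize /= /mrestr setTI.
rewrite (gt_eqF Y0) (negPf Yoo) /=.
by rewrite -[in RHS](fineK Yfin) inver fine_eq0// (gt_eqF Y0).
Qed.

End Dynamics.

Section Observable.
Local Open Scope ereal_scope.
Context {d : measure_display} {R : realType} {X : measurableMetricType d R}.

Record observable (phi : X -> \bar R) (zeta : X) : Prop := {
  observable_measurable : measurable_fun [set: X] phi;
  observable_ninfty : forall x, phi x != -oo;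
  observable_max : forall x, x != zeta -> phi x < phi zeta;
  observable_dist : exists (g : R -> \bar R) (delta : R),
    [/\ (0 < delta)%R,
        (forall x, phi x = g (mdist x zeta)),
        {within `[0%R, delta[, continuous g} &
        {in `[0%R, delta[ &, forall s t, (s < t)%R -> g t < g s}];
  observable_ball : exists2 u0 : \bar R, u0 < phi zeta &
    forall u : R, u0 < u%:E -> u%:E < phi zeta ->
      exists2 r : R, (0 < r)%R & [set x | u%:E < phi x] = ball zeta r
}.

End Observable.

Section Intervals.
Context {R : realType}.

Definition interval_semiring : set (set R) :=
  [set I | exists a b : R, [/\ 0 <= a, 0 <= b & I = `[a, b[%classic]].

Definition interval_ring : set (set R) := <<r interval_semiring>>.

Definition thicken (eta : R) (I : set R) : set R :=
  if 0 < eta then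
    \bigcup_(s in I) (`]s - eta, s + eta[%classic `&` `[0, +oo[%classic)
  else I.

End Intervals.

Section CountingMeasures.
Context (R : realType).

(* A counting measure on [0, +oo[ is represented as a Borel measure on R
   giving no mass to ]-oo, 0[. *)
Record counting_measure := CountingMeasure {
  counting_measure_val :> {measure set R -> \bar R};
  counting_measure_support : counting_measure_val `]-oo, 0[%classic = 0%E;
  counting_measure_nat : forall (K : R) (A : set R), measurable A ->
    A `<=` `[0, K]%classic -> exists k : nat, counting_measure_val A = k%:R%:E
}.

Definition test_function : Type := {psi : R -> R |
  {within `[0, +oo[%classic, continuous psi} /\
  exists K : R, forall t, K < t -> psi t = 0}.

HB.instance Definition _ := gen_eqMixin test_function.
HB.instance Definition _ := gen_choiceMixin test_function.

Definition vague_eval (nu : counting_measure)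
    : prod_topology (fun _ : test_function => R) :=
  fun psi => \int[nu]_(t in `[0%R, +oo[) (sval psi t).

Lemma mzero_support : (mzero : {measure set R -> \bar R}) `]-oo, 0[%classic = 0%E.
Proof. by []. Qed.

Lemma mzero_nat (K : R) (A : set R) : measurable A -> A `<=` `[0, K]%classic ->
  exists k : nat, (mzero : {measure set R -> \bar R}) A = k%:R%:E.
Proof. by exists 0%N. Qed.

Definition counting_measure0 := CountingMeasure mzero_support mzero_nat.

HB.instance Definition _ := gen_eqMixin counting_measure.
HB.instance Definition _ := gen_choiceMixin counting_measure.
HB.instance Definition _ := isPointed.Build counting_measure counting_measure0.
HB.instance Definition _ :=
  Topological.copy counting_measure (initial_topology vague_eval).

End CountingMeasures.

Section WeakConvergence.
Context {R : realType}.
Local Notation Mp := (counting_measure R).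
Local Notation borelMp := (g_sigma_algebraType [set U : set Mp | open U]).

Definition point_process {d} {T : measurableType d} (Z : T -> Mp) : Prop :=
  measurable_fun [set: T] (Z : T -> borelMp).

Definition law {d} {T : measurableType d} (m : probability T R) (Z : T -> Mp)
  : set borelMp -> \bar R := pushforward m (Z : T -> borelMp).

Definition weak_cvg (nu_ : nat -> set borelMp -> \bar R)
    (nu : set borelMp -> \bar R) : Prop :=
  forall Phi : Mp -> R, continuous Phi ->
    (exists M : R, forall z, `|Phi z| <= M) ->
    (fun n => \int[nu_ n]_z (Phi z)%:E)%E @ \oo --> (\int[nu]_z (Phi z)%:E)%E.

Definition cvg_in_law {d d'} {T : measurableType d} {T' : measurableType d'}
    (m : probability T R) (Z_ : nat -> T -> Mp)
    (P : probability T' R) (Z : T' -> Mp) : Prop :=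
  weak_cvg (fun n => law m (Z_ n)) (law P Z).

End WeakConvergence.

Section RareEvents.
Context {R : realType}.
Local Open Scope ereal_scope.

(* Unit mass at j / v for each j with e j; as j / v belongs to J exactly when
   j belongs to v J, the mass of J is the number of j in v J with e j. *)
Definition exceedance_measure (v : R) (e : nat -> bool)
    : {measure set R -> \bar R} :=
  mseries (fun j => mscale (NngNum (ler0n R (e j))) \d_((j%:R / v)%R)) 0.

Lemma exceedance_measure_series (v : R) (e : nat -> bool) (J : set R) :
  exceedance_measure v e J =
  \sum_(0 <= j <oo) (e j && ((j%:R / v)%R \in J))%:R%:E.
Proof.
by apply: eq_eseriesr => j _; rewrite -mulnb natrM.
Qed.

Lemma exceedance_measureE (v : R) (e : nat -> bool) (J : set R) : (0 < v)%R ->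
  exceedance_measure v e J =
  \esum_(j in [set j : nat | [set (v * t)%R | t in J] j%:R]) (e j)%:R%:E.
Proof.
move=> v0; rewrite exceedance_measure_series nneseries_esum; last first.
  by move=> j _; rewrite lee_fin.
rewrite esum_mkcond [RHS]esum_mkcond; apply: eq_esum => j _.
rewrite mem_set//; have -> : (j \in [set j : nat | [set (v * t)%R | t in J] j%:R])
    = ((j%:R / v)%R \in J).
  apply/idP/idP; rewrite !inE.
    by move=> [t Jt <-]; rewrite mulrC mulKf// gt_eqF.
  by exists (j%:R / v)%R => //; rewrite mulrC divfK// gt_eqF.
by case: ifPn => _; rewrite ?andbT ?andbF.
Qed.

Lemma exceedance_measure_support (v : R) (e : nat -> bool) : (0 < v)%R ->
  exceedance_measure v e `]-oo, 0%R[%classic = 0.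
Proof.
move=> v0; rewrite exceedance_measureE// esum1// => j [t /=].
by rewrite in_itv/= => t0 vtj; move: (pmulr_rlt0 t v0); rewrite vtj t0 ltrn0.
Qed.

Lemma exceedance_measure_nat (v : R) (e : nat -> bool) : (0 < v)%R ->
  forall (K : R) (A : set R), measurable A -> A `<=` `[0%R, K]%classic ->
  exists k : nat, exceedance_measure v e A = k%:R%:E.
Proof.
move=> v0 K A mA AK; set n := (Num.truncn (v * K)).+1.
exists (\sum_(0 <= j < n) (e j && ((j%:R / v)%R \in A)))%N.
rewrite exceedance_measure_series (nneseries_split 0 n); last first.
  by move=> j _; rewrite lee_fin.
rewrite add0n eseries0 ?adde0; last first.
  move=> j nj _; case: (boolP (_ \in A)) => [|_]; last by rewrite andbF.
  rewrite inE => /AK/=; rewrite in_itv/= => /andP[_].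
  rewrite ler_pdivrMr// mulrC => jvK.
  have : (j%:R < n%:R :> R)%R by exact: le_lt_trans jvK (truncnS_gt _).
  by rewrite ltr_nat ltnNge nj.
by rewrite natr_sum -sumEFin.
Qed.

(* The scale v is positive as soon as the exceedance probability is, hence for
   all large n in the intended use; the value for v <= 0 is arbitrary. *)
Definition exceedance_process (v : R) (e : nat -> bool) : counting_measure R :=
  match pselect (0 < v)%R with
  | left v0 => CountingMeasure (exceedance_measure_support e v0)
                               (exceedance_measure_nat e v0)
  | right _ => counting_measure0 R
  end.

Definition rare_event_process {d} {T : measurableType d} (mu : probability T R)
    (g : T -> T) (phi : T -> \bar R) (u : R) (x : T) : counting_measure R :=
  exceedance_process (fine (mu [set y | u%:E < phi y]))^-1
    (fun j => u%:E < phi (iter j g x)).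

End RareEvents.

(* Main.v *)
Require Import Defs.
From HB Require Import structures.
From mathcomp Require Import all_boot all_order all_algebra.
From mathcomp Require Import all_classical all_reals all_analysis.
From mathcomp Require Import measurable_realfun.
From mathcomp Require Import lra ring zify.

(** For a bounded continuous functional [Phi] it suffices that the means of
    [Phi(N_n)] under [mu] and of [Phi(N_n^Y)] under [mu_Y] have difference
    tending to 0.  Write [U_n] for [U(u_n)].

    - As [U_n] lies in [Y], for an orbit starting in [Y] the time [i] of an
      exceedance becomes, in the induced system, the number [S_i] of visits to
      [Y] before [i].  So [N_n] and [N_n^Y] have matching atoms, at [i mu(U_n)]
      and at [S_i mu(U_n) / mu(Y)], and [S_i / i -> mu(Y)] almost everywhere by
      Birkhoff's theorem.  Likewise the atoms of [N_n o f] are those of [N_n]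
      shifted by [mu(U_n)], off [U_n].

    - By invariance the mean of [N_n[0, m]] is at most [m + 1], so that outside
      a set of small measure [N_n[0, m] <= c m] for all [m].  Configurations
      subject to this bound are relatively compact for the vague topology, and
      two such sequences with asymptotically equal atoms are not separated by
      [Phi].  Hence [Phi(N_n) - Phi(N_n^Y) -> 0] in [L^1(mu_Y)] and
      [Phi(N_n o f) - Phi(N_n) -> 0] in [L^1(mu)].

    - The last limit lets one replace [1_Y - mu(Y)] by its Birkhoff averages,
      which are small in [L^1], in its integral against [Phi(N_n)].  So the mean
      of [Phi(N_n)] is asymptotically the same under [mu_Y] and under [mu]. *)

Import Order.TTheory GRing.Theory Num.Theory.
Import numFieldNormedType.Exports.

Local Open Scope classical_set_scope.
Local Open Scope ring_scope.

(** * Atomic measures and vague convergence *)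

Section PointMeasure.
Context {R : realType}.
Local Notation Mp := (counting_measure R).

Definition point_measure (e : nat -> bool) (p : nat -> R)
    : {measure set R -> \bar R} :=
  mseries (fun j => mscale (NngNum (ler0n R (e j))) \d_(p j)) 0.

Lemma measurable_test_function (psi : test_function R) :
  measurable_fun (`[0, +oo[%classic : set R) (sval psi).
Proof.
case: psi => psi [cpsi Kpsi] /=.
by apply: subspace_continuous_measurable_fun.
Qed.

Lemma integral_atom (D : set R) (mD : measurable D) (f : R -> R)
    (mf : measurable_fun D f) (b : bool) (t : R) : D t ->
  (\int[mscale (NngNum (ler0n R b)) \d_t]_(x in D) (f x)%:E
   = (b%:R * f t)%:E)%E.
Proof.
move=> Dt; case: b => /=.
  rewrite (eq_measure_integral \d_t) => [|A mA AD]; last first.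
    exact: mul1e.
  rewrite integral_dirac//; last exact/measurable_EFinP.
  by rewrite diracE mem_set// mul1e mul1r.
rewrite (eq_measure_integral mzero) => [|A mA AD]; last first.
  exact: mul0e.
by rewrite integral_measure_zero mul0r.
Qed.

Lemma eseries_trunc (g : nat -> R) (n : nat) :
  (forall j, (n <= j)%N -> g j = 0) ->
  (\sum_(0 <= j <oo) (g j)%:E = (\sum_(j < n) g j)%:E)%E.
Proof.
move=> g0; apply: (@lim_near_cst (\bar R)) => //.
near=> m; have nm : (n <= m)%N by near: m; exact: nbhs_infty_ge.
rewrite (@big_cat_nat _ _ _ n)//=.
have -> : (\sum_(n <= j < m) (g j)%:E = 0)%E.
  by rewrite big_nat_cond big1// => j /andP[/andP[nj _] _]; rewrite g0.
by rewrite adde0 big_mkord -sumEFin.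
Unshelve. all: by end_near. Qed.

Lemma integral_point_measure (e : nat -> bool) (p : nat -> R) (n : nat)
    (psi : test_function R) : (forall j, 0 <= p j) ->
  (forall j, (n <= j)%N -> e j -> sval psi (p j) = 0) ->
  \int[point_measure e p]_(t in `[0, +oo[) sval psi t =
  \sum_(j < n | e j) sval psi (p j).
Proof.
move=> p0 psi0; set D : set R := `[0, +oo[%classic.
have mD : measurable D by exact: measurable_itv.
have mpsi := measurable_test_function psi.
have Dp j : D (p j) by rewrite /D/= in_itv/= p0.
(* Integrating term by term against a sum of measures requires absolute summability, here for the
   positive and for the negative part of the test function; from index [n] on all terms vanish. *)
have H (g : R -> R) : measurable_fun D g ->
    (forall j, (n <= j)%N -> e j -> g (p j) = 0) ->
    (\sum_(0 <= j <oo)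
      `|\int[mscale (NngNum (ler0n R (e j))) \d_(p j)]_(x in D) (g x)%:E|
      < +oo)%E.
  move=> mg g0; under eq_eseriesr => j _ do rewrite integral_atom//.
  rewrite (eseries_trunc (fun j => `|(e j)%:R * g (p j)|) n) ?ltry// => j nj.
  by case: (boolP (e j)) => ej; rewrite ?mul0r ?normr0 ?g0// mulr0 normr0.
rewrite /Rintegral integral_measure_series//.
- under eq_eseriesr => j _ do rewrite integral_atom//.
  rewrite (eseries_trunc (fun j => (e j)%:R * sval psi (p j)) n)/= => [|j nj].
    rewrite [RHS]big_mkcond/=; apply: eq_bigr => j _.
    by case: (e j); rewrite ?mul1r ?mul0r.
  by case: (boolP (e j)) => ej; rewrite ?mul0r ?psi0 ?mulr0.
- move=> j; apply/integrableP; split; first exact/measurable_EFinP.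
  under eq_integral do rewrite /= -abse_EFin/= .
  by rewrite integral_atom ?ltry//; exact: measurableT_comp.
- exact/measurable_EFinP.
- have -> := funerneg (sval psi); apply: H; first exact: measurable_funrneg.
  by move=> j nj ej; rewrite /funrneg psi0// oppr0 maxxx.
- have -> := funerpos (sval psi); apply: H; first exact: measurable_funrpos.
  by move=> j nj ej; rewrite /funrpos psi0// maxxx.
Qed.

(** An open set of an initial topology is the preimage of an open set, and convergence in a product
    is coordinatewise. The filter is general because some limits below run along ultrafilters. *)
Lemma cvg_vague {I : Type} (F : set_system I) {FF : Filter F} (nu_ : I -> Mp)
    (nu : Mp) :
  (forall psi : test_function R,
    vague_eval (nu_ i) psi @[i --> F] --> vague_eval nu psi) ->
  nu_ i @[i --> F] --> nu.
Proof.
move=> H U; rewrite nbhsE => -[B [[C oC <-] Cnu] BU].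
have : (@vague_eval R \o nu_) @ F --> vague_eval nu.
  apply/cvg_sup => psi A; rewrite nbhsE => -[_ [[V oV <-] Vpsi] VA].
  apply: (@filterS _ F _ ((fun i => vague_eval (nu_ i) psi) @^-1` V)).
    by move=> i Vi; apply: VA.
  by apply: (H psi); exact: open_nbhs_nbhs.
move=> /(_ C); rewrite nbhsE/= => /(_ _)FC.
have FC' : F ((@vague_eval R \o nu_) @^-1` C) by apply: FC; exists C.
rewrite nbhs_filterE /=.
by apply: (@filterS _ F FF _ _ _ FC') => i Ci; exact: BU.
Qed.

End PointMeasure.

(** * Enumeration of the hits of a boolean sequence *)

Section Enumeration.
Implicit Types (e : nat -> bool) (n i k : nat).

Definition hits e n : nat := (\sum_(i < n) e i)%N.

Lemma hitsS e n : hits e n.+1 = (hits e n + e n)%N.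
Proof. by rewrite /hits big_ord_recr. Qed.

Lemma hits_mono e n n' : (n <= n')%N -> (hits e n <= hits e n')%N.
Proof.
elim: n' => [|n' IH]; first by rewrite leqn0 => /eqP ->.
rewrite leq_eqVlt => /predU1P[->//|]; rewrite ltnS => /IH /leq_trans; apply.
by rewrite hitsS leq_addr.
Qed.

Lemma hits_le e n : (hits e n <= n)%N.
Proof.
elim: n => [|n IH]; first by rewrite /hits big_ord0.
by rewrite hitsS -[X in (_ <= X)%N]addn1 leq_add//; case: (e n).
Qed.

Lemma hits_inj e i j : e i -> e j -> hits e i = hits e j -> i = j.
Proof.
move=> ei ej; wlog ij : i j ei ej / (i <= j)%N => [H E|E].
  by case: (leqP i j) => [|/ltnW] ij; [apply: H|apply/esym/H].
apply/eqP; rewrite eqn_leq ij leqNgt; apply/negP => /(hits_mono e).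
by rewrite hitsS ei E addn1 ltnn.
Qed.

Definition is_hit_index e k := `[< exists2 i, e i & hits e i = k >].

(* The index of the k-th hit, counting from 0; when there are at most k hits
   the value 0 is meaningless. *)
Definition hit_index e k : nat :=
  if pselect (exists i, e i && (hits e i == k)) is left h then ex_minn h else 0%N.

Lemma hit_indexP e k : is_hit_index e k ->
  e (hit_index e k) /\ hits e (hit_index e k) = k.
Proof.
move=> /asboolP[i ei ik]; rewrite /hit_index; case: pselect => [h|].
  by case: ex_minnP => m /andP[em /eqP].
by case; exists i; rewrite ei ik/=.
Qed.

Lemma hit_indexK e i : e i -> hit_index e (hits e i) = i.
Proof.
move=> ei; have /hit_indexP[eh] : is_hit_index e (hits e i).
  by apply/asboolP; exists i.
exact: hits_inj.
Qed.

Lemma sum_hits (V : nmodType) e (G : nat -> V) n :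
  \sum_(i < n | e i) G i = \sum_(k < hits e n) G (hit_index e k).
Proof.
elim: n => [|n IH]; first by rewrite /hits !big_ord0.
rewrite big_mkcond big_ord_recr/= -big_mkcond IH hitsS.
case: (boolP (e n)) => en; last by rewrite addr0 addn0.
by rewrite addn1 big_ord_recr/= hit_indexK.
Qed.

Lemma is_hit_index_lt e n k : (k < hits e n)%N -> is_hit_index e k.
Proof.
elim: n => [|n IH]; first by rewrite /hits big_ord0.
rewrite hitsS; case: (boolP (e n)) => en; last by rewrite addn0.
rewrite addn1 ltnS leq_eqVlt => /predU1P[->|//].
by apply/asboolP; exists n.
Qed.

Lemma hit_index_ge e n k : is_hit_index e k -> (hits e n <= k)%N ->
  (n <= hit_index e k)%N.
Proof.
move=> /hit_indexP[eh hk] nk; rewrite leqNgt; apply/negP => hn.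
have := hits_mono e _ _ hn; rewrite hitsS eh hk addn1 => /leq_trans/(_ nk).
by rewrite ltnn.
Qed.

(** The range on the right depends only on the bound [c]: sequences with a common bound give sums
    over the same indices, whose limit can be taken term by term. Hits from [n] on may appear on the
    right, with value 0. *)
Lemma sum_hits_le (V : nmodType) e (G : nat -> V) n c : (hits e n <= c)%N ->
  (forall i, (n <= i)%N -> e i -> G i = 0) ->
  \sum_(i < n | e i) G i = \sum_(k < c | is_hit_index e k) G (hit_index e k).
Proof.
move=> nc G0; rewrite sum_hits.
rewrite (big_ord_widen_cond c xpredT (fun k => G (hit_index e k)))//.
rewrite big_mkcond [RHS]big_mkcond; apply: eq_bigr => k _ /=.
case: (ltnP k (hits e n)) => [/is_hit_index_lt -> //|hk].
case: ifPn => // bk; rewrite G0//; first exact: hit_index_ge.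
by have [] := hit_indexP _ _ bk.
Qed.

End Enumeration.

(** * Limits of configurations along ultrafilters *)

Section Limit.
Context {R : realType}.
Local Notation Mp := (counting_measure R).

Lemma point_measureE (e : nat -> bool) (p : nat -> R) (A : set R) :
  point_measure e p A = (\sum_(0 <= j <oo) ((e j && (p j \in A))%:R)%:E)%E.
Proof. by apply: eq_eseriesr => j _; rewrite -mulnb natrM. Qed.

Lemma point_measure_support (e : nat -> bool) (p : nat -> R) :
  (forall j, 0 <= p j) -> point_measure e p `]-oo, 0[%classic = 0%E.
Proof.
move=> p0; rewrite point_measureE eseries0// => j _ _.
case: (boolP (_ \in _)) => [|_]; last by rewrite andbF.
by rewrite inE/= in_itv/= ltNge p0.
Qed.

Lemma point_measure_nat (e : nat -> bool) (p : nat -> R) :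
  (forall K, exists n, forall j, (n <= j)%N -> e j -> K < p j) ->
  forall (K : R) (A : set R), measurable A -> A `<=` `[0, K]%classic ->
  exists k : nat, point_measure e p A = k%:R%:E.
Proof.
move=> pfin K A mA AK; have [n np] := pfin K.
exists (\sum_(j < n) (e j && (p j \in A)))%N.
rewrite point_measureE.
rewrite (eseries_trunc (fun j => (e j && (p j \in A))%:R) n) ?natr_sum// => j nj.
case: (boolP (e j)) => //= ej; case: (boolP (_ \in _)) => //.
rewrite inE => /AK/=; rewrite in_itv/= => /andP[_].
by rewrite leNgt np.
Qed.

Definition point_counting (e : nat -> bool) (p : nat -> R)
    (p0 : forall j, 0 <= p j)
    (pfin : forall K, exists n, forall j, (n <= j)%N -> e j -> K < p j) : Mp :=
  CountingMeasure (point_measure_support e p p0) (point_measure_nat e p pfin).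

Lemma test_function_cvg (psi : test_function R) {I : Type} (F : set_system I)
    {FF : Filter F} (t : I -> R) (s : R) : 0 <= s ->
  (\forall i \near F, 0 <= t i) -> t i @[i --> F] --> s ->
  sval psi (t i) @[i --> F] --> sval psi s.
Proof.
case: psi => psi [cpsi Kpsi] /= s0 t0 ts.
have Ds : `[0, +oo[%classic s by rewrite /= in_itv/= s0.
move/subspace_continuousP : cpsi => /(_ s Ds) cpsi.
apply: (cvg_comp t psi _ cpsi) => A /=; rewrite /within/= => /ts /=.
rewrite !nbhs_filterE /= => tA; apply: (@filterS2 _ F FF _ _ _ _ tA t0) => i /= + ti.
by apply; rewrite in_itv/= ti.
Qed.

(* [b i k] tells whether the k-th atom is present and [t i k] is its position;
   in the limit the atom either converges or escapes to infinity. *)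
Definition point_limit {I : Type} (F : set_system I) (b : I -> nat -> bool)
    (t : I -> nat -> R) (b' : nat -> bool) (t' : nat -> R) : Prop :=
  forall k, if b' k then (\forall i \near F, b i k) /\ t i k @[i --> F] --> t' k
    else forall M, \forall i \near F, b i k -> M < t i k.

(** An atom that the ultrafilter keeps present in some bounded interval has a cluster point there by
    compactness, and a cluster point of an ultrafilter is a limit. Every other atom escapes. *)
Lemma point_limit_exists {I : Type} (F : set_system I) {FU : UltraFilter F}
    (b : I -> nat -> bool) (t : I -> nat -> R) :
  (\forall i \near F, forall k, 0 <= t i k) ->
  exists b' t', (forall k, 0 <= t' k) /\ point_limit F b t b' t'.
Proof.
move=> t0.
suff /choice[bt' H] : forall k, exists bt : bool * R, 0 <= bt.2 /\
    if bt.1 then (\forall i \near F, b i k) /\ t i k @[i --> F] --> bt.2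
    else forall M, \forall i \near F, b i k -> M < t i k.
  by exists (fun k => (bt' k).1), (fun k => (bt' k).2); split=> k; case: (H k).
move=> k; have [[M FM]|FM] :=
    pselect (exists M, \forall i \near F, b i k /\ t i k <= M); last first.
  exists (false, 0); split => // M /=.
  have [FA|] := in_ultra_setVsetC (fun i => b i k /\ t i k <= M) FU.
    by exfalso; apply: FM; exists M.
  by apply: filterS => i /= nA bi; rewrite ltNge; apply/negP => ti; apply: nA.
have [|s [s0M clus]] := @segment_compact R 0 M (t^~ k @ F) _.
  rewrite nbhs_filterE /=; apply: (@filterS2 _ F _ _ _ _ _ t0 FM) => i /= ti [_ tM].
  by rewrite in_itv/= ti tM.
move: s0M => /=; rewrite in_itv/= => /andP[s0 _].
exists (true, s); split => //=; split => [|V nV].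
  by apply: filterS FM => i [].
have [//|nFV] := in_ultra_setVsetC (t^~ k @^-1` V) FU.
by have [r [/=]] := clus (~` V) V nFV nV.
Qed.

End Limit.

Section VagueLimit.
Context {R : realType}.
Local Notation Mp := (counting_measure R).

Section fixed_limit.
Context {I : Type} (F : set_system I) {FF : ProperFilter F}.
Variables (b : I -> nat -> bool) (b' : nat -> bool) (t' : nat -> R).
Variable (c : nat -> nat).

(** At most [c m] atoms lie in [[0, m]], uniformly in [i]: the criterion for relative compactness in
    the vague topology. *)
Definition locally_bounded (t : I -> nat -> R) :=
  \forall i \near F, (forall k, 0 <= t i k) /\
    forall m k, (c m <= k)%N -> b i k -> m%:R < t i k.

Lemma point_limit_locally_bounded (t : I -> nat -> R) : locally_bounded t ->
  point_limit F b t b' t' ->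
  forall m k, (c m <= k)%N -> b' k -> m%:R <= t' k.
Proof.
move=> tc lim m k mk b'k; have := lim k; rewrite b'k => -[bk tk].
apply: (@closed_cvg _ _ F FF (t^~ k) [set x | m%:R <= x]) tk; first exact: closed_ge.
by apply: (@filterS2 _ F _ _ _ _ _ tc bk) => i [_ /(_ m k mk)] + bik => /(_ bik) /ltW.
Qed.

Lemma point_limit_fin :
  (forall m k, (c m <= k)%N -> b' k -> m%:R <= t' k) ->
  forall K, exists n, forall j, (n <= j)%N -> b' j -> K < t' j.
Proof.
(* Only a weak inequality survives in the limit, so the integer level is taken strictly above
   [K]. *)
move=> t'b K; exists (c (Num.truncn K).+1) => j cj bj.
by apply: lt_le_trans (t'b _ _ cj bj); exact: truncnS_gt.
Qed.

(** A test function vanishing from [m] on sees only the first [c m] atoms, so its integral is a sum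
    of fixed length. Each term converges: by continuity if the atom has a limit, and because it is
    eventually 0 if the atom escapes. *)
Lemma vague_cvg_point_limit (t : I -> nat -> R) (t'0 : forall k, 0 <= t' k)
    (t'fin : forall K, exists n, forall j, (n <= j)%N -> b' j -> K < t' j)
    (t'b : forall m k, (c m <= k)%N -> b' k -> m%:R <= t' k)
    (nu : I -> Mp) :
  (\forall i \near F, forall k, 0 <= t i k) ->
  point_limit F b t b' t' ->
  (forall (psi : test_function R) m, (forall s, m%:R <= s -> sval psi s = 0) ->
    \forall i \near F,
      vague_eval (nu i) psi = \sum_(k < c m | b i k) sval psi (t i k)) ->
  nu i @[i --> F] --> point_counting b' t' t'0 t'fin.
Proof.
move=> t0 lim nuE; apply: cvg_vague => psi.
have [K psiK] : exists K : R, forall t, K < t -> sval psi t = 0.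
  by case: (svalP psi).
pose m := (Num.truncn K).+1.
have psim s : m%:R <= s -> sval psi s = 0.
  by move=> ms; apply: psiK; apply: lt_le_trans ms; exact: truncnS_gt.
have -> : vague_eval (point_counting b' t' t'0 t'fin) psi =
    \sum_(k < c m) if b' k then sval psi (t' k) else 0.
  rewrite /vague_eval/= (integral_point_measure _ _ (c m))//.
    by rewrite big_mkcond.
  by move=> j cj bj; apply: psim; exact: t'b cj bj.
apply: (@cvg_trans _ ((fun i =>
    \sum_(k < c m) if b i k then sval psi (t i k) else 0) @ F)).
  apply: near_eq_cvg; apply: filterS (nuE psi m psim) => i ->.
  by rewrite [RHS]big_mkcond.
have sum_cvg (g : nat -> I -> R) (l : nat -> R) n :
    (forall k, g k i @[i --> F] --> l k) ->
    \sum_(k < n) g k i @[i --> F] --> \sum_(k < n) l k.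
  move=> gl; elim: n => [|n IH].
    by under eq_fun do rewrite big_ord0; rewrite big_ord0; exact: cvg_cst.
  by under eq_fun do rewrite big_ord_recr/=; rewrite big_ord_recr/=; exact: cvgD.
apply: (sum_cvg (fun k i => if b i k then sval psi (t i k) else 0)
  (fun k => if b' k then sval psi (t' k) else 0)) => k.
have := lim k; case: (b' k) => [[bk tk]|tM].
  apply: (@cvg_trans _ ((fun i => sval psi (t i k)) @ F)).
    by apply: near_eq_cvg; apply: filterS bk => i ->.
  apply: test_function_cvg => //; apply: filterS t0 => i; exact.
apply: (@cvg_trans _ ((fun i => 0 : R) @ F)); last exact: cvg_cst.
apply: near_eq_cvg; apply: filterS (tM K) => i; case: (b i k) => // /(_ isT).
by move/psiK => ->.
Qed.

End fixed_limit.

(* Sequences separated by [Phi] would stay so along an ultrafilter, along which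
   both have the same limit configuration. *)
Lemma close_configurations (Phi : Mp -> R) (Phi_cont : continuous Phi)
    (S : set nat) (e : nat -> nat -> bool) (v : nat -> R) (c : nat -> nat)
    (q : nat -> nat -> R) (nu nu' : nat -> Mp) :
  (forall n, S n -> 0 < v n) ->
  (forall n, S n -> forall m, (hits (e n) (Num.truncn (v n * m%:R)).+1 <= c m)%N) ->
  (forall n, S n -> forall i, 0 <= q n i) ->
  (forall eta, 0 < eta -> \forall n \near \oo, S n -> forall i, e n i ->
    `|q n i - i%:R / v n| <= eta * (1 + i%:R / v n)) ->
  (forall n, S n -> forall (psi : test_function R) n0,
    (forall i, (n0 <= i)%N -> e n i -> sval psi (i%:R / v n) = 0) ->
    vague_eval (nu n) psi = \sum_(i < n0 | e n i) sval psi (i%:R / v n)) ->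
  (forall n, S n -> forall (psi : test_function R) n0,
    (forall i, (n0 <= i)%N -> e n i -> sval psi (q n i) = 0) ->
    vague_eval (nu' n) psi = \sum_(i < n0 | e n i) sval psi (q n i)) ->
  forall eps, 0 < eps ->
    \forall n \near \oo, S n -> `|Phi (nu n) - Phi (nu' n)| < eps.
Proof.
move=> v0 hc q0 qp nuE nu'E eps eps0; apply: contrapT => nfar.
pose far := [set n | S n /\ eps <= `|Phi (nu n) - Phi (nu' n)|].
have PF : ProperFilter (within far \oo).
  split; last exact: within_filter.
  rewrite /within/= => nnear; apply: nfar; apply: filterS nnear => n /= + Sn.
  by move=> H; rewrite ltNge; apply/negP => farn; apply: H.
have [F [FU leF]] := ultraFilterLemma PF.
have Foo : \oo `<=` F.
  by move=> A Aoo; apply: leF; rewrite /within/=; apply: filterS Aoo.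
have Ffar : F far by apply: leF; exact: withinT.
have FS : \forall n \near F, S n by apply: filterS Ffar => n [].
pose b n k := is_hit_index (e n) k.
pose t n k := (hit_index (e n) k)%:R / v n.
pose s n k := if b n k then q n (hit_index (e n) k) else 0.
have t0 : \forall n \near F, forall k, 0 <= t n k.
  by apply: filterS FS => n Sn k; rewrite divr_ge0// ltW// v0.
have s0 : \forall n \near F, forall k, 0 <= s n k.
  by apply: filterS FS => n Sn k; rewrite /s; case: ifP => // _; exact: q0.
have tc : locally_bounded F b c t.
  apply: filterS2 t0 FS => n tn Sn; split => // m k cmk bk.
  have := hit_index_ge _ _ _ bk (leq_trans (hc n Sn m) cmk).
  rewrite /t ltr_pdivlMr ?v0// mulrC -(ler_nat R) => /(lt_le_trans _); apply.
  exact: truncnS_gt.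
have st eta : 0 < eta -> \forall n \near F, forall k, b n k ->
    `|s n k - t n k| <= eta * (1 + t n k).
  move=> eta0; apply: filterS2 FS (Foo _ (qp eta eta0)) => n Sn qpn k bk.
  by rewrite /s bk; apply: qpn => //; have [] := hit_indexP _ _ bk.
have [b' [t' [t'0 lim]]] := point_limit_exists F b t t0.
(* A displacement by at most a third of [1 + p] leaves an atom from beyond [2 * M + 1] beyond [M];
   hence atoms that escape in [nu] also escape in [nu']. *)
have third0 : 0 < 3^-1 :> R by rewrite invr_gt0.
have far_away (M p r : R) : 0 <= p -> `|r - p| <= 3^-1 * (1 + p) ->
    2 * M + 1 < p -> M < r.
  by move=> p0; rewrite ler_distl => /andP[rp _] Mp; lra.
have lims : point_limit F b s b' t'.
  move=> k; have := lim k; case: (b' k) => [[bk tk]|tM].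
    split => //; have st0 : (s n k - t n k) @[n --> F] --> 0.
      apply/cvgr0Pnorm_le => r r0.
      have tk2 : 0 < t' k + 2 by rewrite ltr_wpDl.
      (* Eventually [t n k <= t' k + 1], so that the displacement bound [eta * (1 + t n k)] is at
         most [r]. *)
      pose eta := r / (t' k + 2).
      have eta0 : 0 < eta by rewrite divr_gt0.
      have steta := st _ eta0; near=> n.
      have bnk : b n k by near: n.
      have stn : forall k, b n k -> `|s n k - t n k| <= eta * (1 + t n k).
        by near: n.
      have tn : t n k <= t' k + 1.
        by near: n; apply: (cvgr_le (t' k)) => //; rewrite ltrDl.
      apply: le_trans (stn k bnk) _; rewrite /eta mulrAC ler_pdivrMr// ler_pM2l//.
      by lra.
    rewrite -[t' k]addr0; have -> : s^~ k = (fun n => t n k + (s n k - t n k)).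
      by apply/funext => n; rewrite addrC subrK.
    exact: cvgD.
  have sth := st _ third0.
  move=> M; near=> n => bnk.
  have tn : forall k, 0 <= t n k by near: n.
  have stn : forall k, b n k -> `|s n k - t n k| <= 3^-1 * (1 + t n k) by near: n.
  have tMn : b n k -> 2 * M + 1 < t n k by near: n; exact: tM.
  exact: far_away (tn k) (stn k bnk) (tMn bnk).
have t'b : forall m k, (c m <= k)%N -> b' k -> m%:R <= t' k.
  exact: point_limit_locally_bounded lim.
have t'fin : forall K, exists n, forall j, (n <= j)%N -> b' j -> K < t' j.
  exact: point_limit_fin t'b.
have nulim : nu n @[n --> F] --> point_counting b' t' t'0 t'fin.
  apply: (vague_cvg_point_limit F b b' t' c t) => // psi m psim.
  apply: filterS FS => n Sn.
  have zero i : ((Num.truncn (v n * m%:R)).+1 <= i)%N -> e n i ->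
      sval psi (i%:R / v n) = 0.
    move=> mi ei; apply: psim; rewrite ler_pdivlMr ?v0// mulrC ltW//.
    by apply: lt_le_trans (truncnS_gt _) _; rewrite ler_nat.
  rewrite (nuE n Sn psi _ zero).
  exact: (sum_hits_le _ _ (fun i => sval psi (i%:R / v n)) _ _ (hc n Sn m)).
have nu'lim : nu' n @[n --> F] --> point_counting b' t' t'0 t'fin.
  (* Atoms of [nu'] in [[0, m]] come from atoms of [nu] in [[0, 2m + 1]]. *)
  apply: (vague_cvg_point_limit F b b' t' (fun m => c (2 * m + 1)%N) s) => //.
    move=> m k ck b'k; apply: le_trans (t'b _ _ ck b'k).
    by rewrite ler_nat; lia.
  move=> psi m psim; apply: filterS2 FS (Foo _ (qp _ third0)) => n Sn qpn.
  have zero i : ((Num.truncn (v n * (2 * m + 1)%:R)).+1 <= i)%N -> e n i ->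
      sval psi (q n i) = 0.
    move=> mi ei; apply: psim; apply/ltW/(far_away _ (i%:R / v n)).
    - by rewrite divr_ge0// ltW// v0.
    - exact: qpn.
    have -> : 2 * m%:R + 1 = (2 * m + 1)%:R :> R by rewrite natrD natrM.
    rewrite ltr_pdivlMr ?v0// mulrC.
    by apply: lt_le_trans (truncnS_gt _) _; rewrite ler_nat.
  rewrite (nu'E n Sn psi _ zero).
  rewrite (sum_hits_le _ _ (fun i => sval psi (q n i)) _ _ (hc n Sn _) zero).
  by apply: eq_bigr => k; rewrite /s /b => ->.
have : (Phi (nu n) - Phi (nu' n)) @[n --> F] --> 0.
  rewrite -(subrr (Phi (point_counting b' t' t'0 t'fin))); apply: cvgB.
    by apply: (cvg_comp nu Phi nulim); exact: Phi_cont.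
  by apply: (cvg_comp nu' Phi nu'lim); exact: Phi_cont.
move/cvgr0Pnorm_lt => /(_ eps eps0) near0.
have [n [[_ farn]]] := filter_ex (filterI Ffar near0).
by rewrite ltNge farn.
Unshelve. all: by end_near. Qed.


End VagueLimit.

(** * Exceedances along orbits *)

Section ExceedanceSums.
Context {R : realType}.
Implicit Types (e y : nat -> bool) (v w : R).

Lemma vague_eval_exceedance v e (psi : test_function R) n : 0 < v ->
  (forall i, (n <= i)%N -> e i -> sval psi (i%:R / v) = 0) ->
  vague_eval (exceedance_process v e) psi = \sum_(i < n | e i) sval psi (i%:R / v).
Proof.
move=> v0 psi0; rewrite /vague_eval /exceedance_process; case: pselect => // v0'.
apply: (integral_point_measure e (fun j => j%:R / v)) => // j.
by rewrite divr_ge0// ltW.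
Qed.

(** An exceedance of the shifted sequence at [j] is one of [e] at [j + 1]. An exceedance at time 0
    would have no counterpart, yet [i.-1] would leave it at the origin; hence the condition on
    [e 0]. *)
Lemma vague_eval_exceedance_shift v e (psi : test_function R) n : 0 < v ->
  ~~ e 0%N ->
  (forall i, (n <= i)%N -> e i -> sval psi (i.-1%:R / v) = 0) ->
  vague_eval (exceedance_process v (fun j => e j.+1)) psi =
  \sum_(i < n | e i) sval psi (i.-1%:R / v).
Proof.
move=> v0 e0 psi0; rewrite (vague_eval_exceedance _ _ _ n.-1)//; last first.
  by move=> i ni ei; apply: (psi0 i.+1) => //; case: n ni {psi0}.
case: n {psi0} => [|n]; first by rewrite !big_ord0.
rewrite [RHS]big_mkcond big_ord_recl/= (negbTE e0) add0r [LHS]big_mkcond/=.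
by apply: eq_bigr => i _; rewrite /bump leq0n add0n.
Qed.

(** As exceedances occur only at hits of [y], the map [hits y] matches the exceedance times of [e]
    with those of the induced sequence. Both processes thus become sums over the same times [i],
    with moved atoms. *)
Lemma vague_eval_exceedance_hits w e y (psi : test_function R) n : 0 < w ->
  (forall i, e i -> y i) -> (forall k, is_hit_index y k) ->
  (forall i, (n <= i)%N -> e i -> sval psi ((hits y i)%:R / w) = 0) ->
  vague_eval (exceedance_process w (fun j => e (hit_index y j))) psi =
  \sum_(i < n | e i) sval psi ((hits y i)%:R / w).
Proof.
move=> w0 ey yk psi0; rewrite (vague_eval_exceedance _ _ _ (hits y n))//.
  rewrite big_mkcond (eq_bigl (fun i : 'I_n => y i && e i)); last first.
    by move=> i; case: (boolP (e i)) => [/ey ->|]; rewrite ?andbF.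
  rewrite [RHS]big_mkcondr.
  rewrite (sum_hits _ y (fun i => if e i then sval psi ((hits y i)%:R / w) else 0)).
  by apply: eq_bigr => k _; have [_ ->] := hit_indexP _ _ (yk k).
move=> j nj ej; have := psi0 _ (hit_index_ge _ _ _ (yk j) nj) ej.
by have [_ ->] := hit_indexP _ _ (yk j).
Qed.

End ExceedanceSums.

(** * Visits to a set and the first return map *)

Section ReturnTimes.
Context {d} {T : measurableType d} (f : T -> T) (Y : set T).

Definition visits (x : T) (i : nat) : bool := `[< Y (iter i f x) >].

Lemma hit_index_lt (e : nat -> bool) k : is_hit_index e k -> is_hit_index e k.+1 ->
  (hit_index e k < hit_index e k.+1)%N.
Proof.
move=> /hit_indexP[ek hk] H.
by apply: hit_index_ge => //; rewrite hitsS ek hk addn1.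
Qed.

Lemma hit_index_between (e : nat -> bool) k i : is_hit_index e k ->
  is_hit_index e k.+1 ->
  (hit_index e k < i)%N -> e i -> (hit_index e k.+1 <= i)%N.
Proof.
move=> Hk HSk ki ei; rewrite leqNgt; apply/negP => iSk.
have [ek hk] := hit_indexP _ _ Hk; have [eSk hSk] := hit_indexP _ _ HSk.
have := hits_mono e _ _ ki; rewrite hitsS ek hk addn1 => h1.
have := hits_mono e _ _ iSk; rewrite hitsS ei hSk addn1 => h2.
by have := leq_ltn_trans h1 h2; rewrite ltnn.
Qed.

(** No visit lies strictly between two consecutive ones, so their distance is the first return time.
    Infinitely many visits ensure that the default return time 0 never occurs along the orbit. *)
Lemma iter_first_return_map (x : T) : visits x 0 ->
  (forall k, is_hit_index (visits x) k) ->
  forall k, iter k (first_return_map f Y) x = iter (hit_index (visits x) k) f x.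
Proof.
move=> x0 xk; elim=> [|k IH].
  (* As [x] lies in [Y], time 0 is visit number 0. *)
  by have <- : 0%N = hit_index (visits x) 0;
    rewrite // -[in RHS](_ : hits (visits x) 0 = 0%N) ?hit_indexK// /hits big_ord0.
set r := hit_index _ k in IH *; set r' := hit_index _ k.+1.
have rr' : (r < r')%N by exact: hit_index_lt.
have [Yr' _] := hit_indexP _ _ (xk k.+1).
rewrite iterS IH /first_return_map.
suff -> : first_return_time f Y (iter r f x) = (r' - r)%N.
  by rewrite -iterD subnK// ltnW.
rewrite /first_return_time; case: pselect => [h|]; last first.
  case; exists (r' - r)%N; rewrite subn_gt0 rr'/=.
  by rewrite -iterD subnK// ltnW.
case: ex_minnP => m /andP[m0]; rewrite -iterD => Ym minm.
apply/eqP; rewrite eqn_leq; apply/andP; split.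
  apply: minm; rewrite subn_gt0 rr'/= -iterD subnK//; exact: ltnW.
rewrite leq_subLR addnC; apply: hit_index_between => //.
by rewrite -[X in (X < _)%N]add0n ltn_add2r.
Qed.

End ReturnTimes.

(** * Bounded measurable functions *)

Section BoundedMeasurable.
Context {d} {T : measurableType d} {R : realType}.
Implicit Types g h : T -> R.

(** A class stable under the operations used below and integrable for every probability, so that
    real-valued integrals can be handled without further integrability arguments. *)
Definition bounded_measurable g : Prop :=
  measurable_fun [set: T] g /\ exists M : R, forall x, `|g x| <= M.

Lemma bounded_measurable_cst (r : R) : bounded_measurable (cst r).
Proof. by split => //; exists `|r|. Qed.

Lemma bounded_measurable_indic (A : set T) : measurable A ->
  bounded_measurable (\1_A).
Proof.
move=> mA; split; first exact: measurable_indic.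
by exists 1 => x; rewrite indicE normr_nat lern1 leq_b1.
Qed.

Lemma bounded_measurableD g h : bounded_measurable g -> bounded_measurable h ->
  bounded_measurable (fun x => g x + h x).
Proof.
move=> [mg [M gM]] [mh [K hK]]; split; first exact: measurable_funD.
by exists (M + K) => x; apply: le_trans (ler_normD _ _) _; exact: lerD.
Qed.

Lemma bounded_measurableM g h : bounded_measurable g -> bounded_measurable h ->
  bounded_measurable (fun x => g x * h x).
Proof.
move=> [mg [M gM]] [mh [K hK]]; split; first exact: measurable_funM.
by exists (M * K) => x; rewrite normrM ler_pM.
Qed.

Lemma bounded_measurableB g h : bounded_measurable g -> bounded_measurable h ->
  bounded_measurable (fun x => g x - h x).
Proof.
move=> bg bh; have := bounded_measurableD _ _ bg
  (bounded_measurableM _ _ (bounded_measurable_cst (-1)) bh).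
by under eq_fun do rewrite mulN1r.
Qed.

Lemma bounded_measurable_norm g : bounded_measurable g ->
  bounded_measurable (fun x => `|g x|).
Proof.
move=> [mg [M gM]]; split; first exact: measurableT_comp.
by exists M => x; rewrite normr_id.
Qed.

Lemma bounded_measurable_max g h : bounded_measurable g -> bounded_measurable h ->
  bounded_measurable (fun x => Num.max (g x) (h x)).
Proof.
move=> [mg [M gM]] [mh [K hK]]; split; first exact: measurable_maxr.
exists (Num.max M K) => x; rewrite le_max.
by case: (lerP (h x) (g x)) => _; rewrite ?gM// hK orbT.
Qed.

Lemma bounded_measurable_comp (f : T -> T) g : measurable_fun [set: T] f ->
  bounded_measurable g -> bounded_measurable (g \o f).
Proof.
move=> mf [mg [M gM]]; split; first exact: measurableT_comp.
by exists M => x /=.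
Qed.

Lemma bounded_measurable_sum (g : nat -> T -> R) n :
  (forall i, bounded_measurable (g i)) ->
  bounded_measurable (fun x => \sum_(i < n) g i x).
Proof.
move=> bg; elim: n => [|n IH].
  by under eq_fun do rewrite big_ord0; exact: bounded_measurable_cst.
by under eq_fun do rewrite big_ord_recr/=; exact: bounded_measurableD.
Qed.

Section integral.
Variable mu : probability T R.

Lemma bounded_measurable_integrable g : bounded_measurable g ->
  mu.-integrable [set: T] (EFin \o g).
Proof.
move=> [mg [M gM]]; apply: measurable_bounded_integrable => //.
  by apply: le_lt_trans (probability_le1 mu measurableT) (ltry _).
exists M; split; first exact: num_real.
by move=> r Mr x _; apply: le_trans (gM x) (ltW Mr).
Qed.

Let bmi := bounded_measurable_integrable.

Lemma le_mean g h : bounded_measurable g -> bounded_measurable h ->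
  (forall x, g x <= h x) -> \int[mu]_x g x <= \int[mu]_x h x.
Proof. by move=> bg bh gh; apply: le_Rintegral => //; exact: bmi. Qed.

Lemma meanD g h : bounded_measurable g -> bounded_measurable h ->
  \int[mu]_x (g x + h x) = \int[mu]_x g x + \int[mu]_x h x.
Proof. by move=> bg bh; apply: RintegralD => //; exact: bmi. Qed.

Lemma meanB g h : bounded_measurable g -> bounded_measurable h ->
  \int[mu]_x (g x - h x) = \int[mu]_x g x - \int[mu]_x h x.
Proof. by move=> bg bh; apply: RintegralB => //; exact: bmi. Qed.

Lemma meanZ (r : R) g : bounded_measurable g ->
  \int[mu]_x (r * g x) = r * \int[mu]_x g x.
Proof. by move=> bg; apply: RintegralZl => //; exact: bmi. Qed.

Lemma mean_cst (r : R) : \int[mu]_(x in [set: T]) r = r.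
Proof.
rewrite Rintegral_cst//.
transitivity (r * fine (1%E : \bar R)); last by rewrite /= mulr1.
by congr (_ * fine _); exact: probability_setT.
Qed.

Lemma mean_sum (g : nat -> T -> R) n : (forall i, bounded_measurable (g i)) ->
  \int[mu]_x (\sum_(i < n) g i x) = \sum_(i < n) \int[mu]_x g i x.
Proof.
move=> bg; elim: n => [|n IH].
  by under eq_Rintegral do rewrite big_ord0; rewrite mean_cst big_ord0.
under eq_Rintegral do rewrite big_ord_recr/=.
rewrite meanD//; first by rewrite IH big_ord_recr.
exact: bounded_measurable_sum.
Qed.

Lemma mean_indic (A : set T) : measurable A -> \int[mu]_x \1_A x = fine (mu A).
Proof. by move=> mA; rewrite /Rintegral integral_indic// setIT. Qed.

Lemma le_norm_mean g : bounded_measurable g ->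
  `|\int[mu]_x g x| <= \int[mu]_x `|g x|.
Proof. by move=> bg; apply: le_normr_Rintegral => //; exact: bmi. Qed.

Lemma mean_comp (f : T -> T) g : measurable_fun [set: T] f ->
  invariant_measure mu f -> bounded_measurable g ->
  \int[mu]_x g (f x) = \int[mu]_x g x.
Proof.
move=> mf finv bg; rewrite /Rintegral; congr fine.
have mg : measurable_fun [set: T] (EFin \o g) by apply/measurable_EFinP; case: bg.
have := @integral_pushforward _ _ _ _ R f mf mu setT (EFin \o g) mg.
rewrite preimage_setT => /(_ (bmi _ (bounded_measurable_comp _ _ mf bg))) <-//.
by apply: eq_measure_integral => A mA _; exact: finv.
Qed.

Lemma mean_cvg (g : nat -> T -> R) (h : T -> R) (M : R) :
  (forall n, bounded_measurable (g n)) -> bounded_measurable h ->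
  (forall n x, `|g n x| <= M) ->
  {ae mu, forall x, g n x @[n --> \oo] --> h x} ->
  \int[mu]_x g n x @[n --> \oo] --> \int[mu]_x h x.
Proof.
move=> bg bh gM gh; rewrite /Rintegral.
have mg n : measurable_fun [set: T] (EFin \o g n).
  by apply/measurable_EFinP; case: (bg n).
have mh : measurable_fun [set: T] (EFin \o h) by apply/measurable_EFinP; case: bh.
have gh' : {ae mu, forall x, [set: T] x ->
    (EFin \o g n) x @[n --> \oo] --> (EFin \o h) x}.
  by apply: filterS gh => x gx _; apply: cvg_EFin; [exact: nearW|exact: gx].
have gM' : {ae mu, forall x n, [set: T] x -> (`|(EFin \o g n) x| <= M%:E)%E}.
  by apply: aeW => x n _ /=; rewrite lee_fin.
have [_ _ H] := dominated_convergence measurableT mg mh gh'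
  (bmi _ (bounded_measurable_cst M)) gM'.
apply: fine_cvg.
rewrite fineK; first exact: H.
by apply: integrable_fin_num => //; exact: bmi.
Qed.

End integral.
End BoundedMeasurable.

(** * Birkhoff's theorem for visit frequencies *)

Section Birkhoff.
Context {d} {T : measurableType d} {R : realType}.
Variables (mu : probability T R) (f : T -> T).
Hypotheses (mf : measurable_fun [set: T] f) (f_inv : invariant_measure mu f).

Lemma measurable_iter n : measurable_fun [set: T] (iter n f).
Proof.
elim: n => [|n IH]; first exact: measurable_id.
exact: (measurableT_comp mf IH).
Qed.

Section maximal.
Variable g : T -> R.
Hypothesis bg : bounded_measurable g.

Definition birkhoff_sum n x : R := \sum_(i < n) g (iter i f x).

(* The recursion satisfied by the maximum of 0 and of the first n Birkhoff sums. *)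
Fixpoint birkhoff_max n : T -> R :=
  if n is n'.+1 then fun x => Num.max 0 (g x + birkhoff_max n' (f x)) else cst 0.

Lemma birkhoff_max_bounded n : bounded_measurable (birkhoff_max n).
Proof.
elim: n => [|n IH]; first exact: bounded_measurable_cst.
apply: bounded_measurable_max; first exact: bounded_measurable_cst.
by apply: bounded_measurableD => //; exact: bounded_measurable_comp.
Qed.

Lemma birkhoff_max_ge0 n x : 0 <= birkhoff_max n x.
Proof. by case: n => [//|n] /=; rewrite le_max lexx. Qed.

Lemma birkhoff_maxS n x : birkhoff_max n x <= birkhoff_max n.+1 x.
Proof.
elim: n x => [|n IH] x; first by rewrite le_max lexx.
rewrite [X in _ <= X]/= le_max; apply/orP.
rewrite [birkhoff_max n.+1 x]/=; case: (lerP (g x + birkhoff_max n (f x)) 0) => _.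
  by left.
by right; rewrite lerD2l; exact: IH.
Qed.

Lemma birkhoff_max_mono n n' x : (n <= n')%N ->
  birkhoff_max n x <= birkhoff_max n' x.
Proof.
elim: n' => [|n' IH]; first by rewrite leqn0 => /eqP ->.
rewrite leq_eqVlt => /predU1P[-> //|]; rewrite ltnS => /IH /le_trans; apply.
exact: birkhoff_maxS.
Qed.

Lemma birkhoff_sum_le_max n x : birkhoff_sum n x <= birkhoff_max n x.
Proof.
elim: n x => [|n IH] x; first by rewrite /birkhoff_sum big_ord0.
rewrite /birkhoff_sum big_ord_recl/= le_max; apply/orP; right.
rewrite lerD2l; apply: le_trans (IH (f x)); apply: ler_sum => i _.
by rewrite add0n -iterS iterSr.
Qed.

Let P n := [set x | 0 < birkhoff_max n x].

Let mP n : measurable (P n).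
Proof.
rewrite /P -[X in measurable X]setTI.
by apply: measurable_fun_ltr => //; case: (birkhoff_max_bounded n).
Qed.

(** Garsia's argument. If [m] is the maximum of 0 and the first Birkhoff sums, [m - m o f] is at
    most [g] where [m] is positive and at most 0 elsewhere, while its mean is 0 by invariance. *)
Lemma maximal_inequality n : 0 <= \int[mu]_x (g x * \1_(P n) x).
Proof.
case: n => [|n].
  apply: Rintegral_ge0 => x _; rewrite indicE memNset ?mulr0//.
  by rewrite /P/= ltxx.
have bM := birkhoff_max_bounded n.+1.
have -> : 0 = \int[mu]_x (birkhoff_max n.+1 x - birkhoff_max n.+1 (f x)).
  rewrite meanB//; last exact: bounded_measurable_comp.
  by rewrite mean_comp// subrr.
apply: le_mean.
- by apply: bounded_measurableB => //; exact: bounded_measurable_comp.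
- by apply: bounded_measurableM => //; exact: bounded_measurable_indic.
move=> x; rewrite indicE; case: (boolP (x \in P n.+1)) => Px; last first.
  rewrite mulr0 subr_le0; apply: le_trans (birkhoff_max_ge0 _ _).
  by rewrite leNgt; apply/negP => Px'; move/negP: Px; apply; rewrite inE.
rewrite mulr1 lerBlDr; have := birkhoff_maxS n (f x).
rewrite inE /P/= in Px; move: Px; rewrite lt_max ltxx/= => Px.
by rewrite (max_idPr (ltW Px)) lerD2l.
Qed.

(** The sets [P n] increase to a set of full measure, and dominated convergence carries the maximal
    inequality over to the whole space. *)
Lemma mean_ge0 : {ae mu, forall x, exists n, 0 < birkhoff_sum n x} ->
  0 <= \int[mu]_x g x.
Proof.
move=> gpos; have [M gM] := bg.2.
have lim : \int[mu]_x (g x * \1_(P n) x) @[n --> \oo] --> \int[mu]_x g x.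
  apply: (mean_cvg mu _ _ M) => //.
  - move=> n; apply: bounded_measurableM => //; exact: bounded_measurable_indic.
  - move=> n x; rewrite normrM indicE normr_nat -[leRHS]mulr1 ler_pM//.
    by rewrite lern1 leq_b1.
  apply: filterS gpos => x [n0 n0x].
  apply: (@cvg_trans _ ((fun n => g x) @ \oo)); last exact: cvg_cst.
  apply: near_eq_cvg; near=> n.
  rewrite indicE mem_set ?mulr1// /P/=; apply: (lt_le_trans n0x).
  apply: (le_trans (birkhoff_sum_le_max n0 x)).
  by apply: birkhoff_max_mono; near: n; exact: nbhs_infty_ge.
apply: (@closed_cvg _ _ \oo _ (fun n => \int[mu]_x (g x * \1_(P n) x))
  [set r : R | 0 <= r]) lim; first exact: closed_ge.
by apply: nearW => n; exact: maximal_inequality.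
Unshelve. all: by end_near. Qed.

End maximal.

Section ergodic_frequency.
Hypothesis f_erg : ergodic mu f.

Section visits.
Variable A : set T.
Hypothesis mA : measurable A.

Definition visit_count (x : T) (n : nat) : nat := hits (visits f A x) n.

Lemma visit_countE x n : (visit_count x n)%:R = birkhoff_sum \1_A n x.
Proof.
rewrite /visit_count /hits natr_sum; apply: eq_bigr => i _.
by rewrite indicE /visits; congr (_%:R); case: asboolP => [/mem_set ->|/memNset ->].
Qed.

Lemma visit_count_bounded n :
  bounded_measurable (fun x => (visit_count x n)%:R : R).
Proof.
under eq_fun do rewrite visit_countE.
apply: (bounded_measurable_sum (fun i x => \1_A (iter i f x))) => i.
apply: (bounded_measurable_comp (iter i f)); first exact: measurable_iter.
exact: bounded_measurable_indic.
Qed.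

(** Both counts arise from the count of [x] over [n + 1] times by dropping one term, the last or the
    first. *)
Lemma visit_count_shift x n :
  (visit_count x n <= (visit_count (f x) n).+1)%N /\
  (visit_count (f x) n <= (visit_count x n).+1)%N.
Proof.
have E : (visit_count x n.+1 = visits f A x 0 + visit_count (f x) n)%N.
  rewrite /visit_count /hits big_ord_recl; congr addn; apply: eq_bigr => i _.
  by rewrite /visits lift0 -iterSr.
have := E; rewrite {1}/visit_count hitsS -/(visit_count x n).
by case: (visits f A x n); case: (visits f A x 0) => /=; lia.
Qed.

(* The event [limsup_n S_n / n >= b], in a form for which invariance under [f]
   is exact. *)
Definition frequent (b : R) : set T :=
  [set x | forall k N : nat, exists2 n : nat, (N <= n)%N &
    (b - k.+1%:R^-1) * n%:R <= (visit_count x n)%:R].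

Lemma frequentE b : frequent b = \bigcap_k \bigcap_N \bigcup_(n in [set n | (N <= n)%N])
  [set x | (b - k.+1%:R^-1) * n%:R <= (visit_count x n)%:R].
Proof.
apply/seteqP; split=> x.
  by move=> Hx k _ N _; have [n Nn nx] := Hx k N; exists n.
by move=> Hx k N; have [n Nn nx] := Hx k I N I; exists n.
Qed.

Lemma measurable_frequent b : measurable (frequent b).
Proof.
rewrite frequentE; apply: bigcapT_measurable => k.
apply: bigcapT_measurable => N; apply: bigcup_measurable => n _.
rewrite -[X in measurable X]setTI; apply: measurable_fun_ler => //.
by case: (visit_count_bounded n).
Qed.

Lemma frequent_close b x y :
  (forall n, (visit_count x n <= (visit_count y n).+1)%N) ->
  frequent b x -> frequent b y.
Proof.
(* Halving the tolerance [1 / (k + 1)] gains [n / (2 (k + 1))], which is at least 1 for the times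
   considered and absorbs the difference of one visit. *)
move=> xy Hx k N; have [n] := Hx (2 * k + 1)%N (maxn N (2 * k.+1)).
rewrite geq_max => /andP[Nn kn] nx; exists n => //.
have {nx} : (b - (2 * k.+1)%:R^-1) * n%:R <= (visit_count y n)%:R + 1.
  have -> : (2 * k.+1 = (2 * k + 1).+1)%N by lia.
  by apply: le_trans nx _; rewrite natr1 ler_nat.
have -> : (b - (2 * k.+1)%:R^-1) * n%:R =
    (b - k.+1%:R^-1) * n%:R + n%:R / (2 * k.+1)%:R.
  by rewrite natrM; field.
have : 1 <= n%:R / (2 * k.+1)%:R :> R by rewrite ler_pdivlMr ?ltr0n// mul1r ler_nat.
by move: (n%:R / _) ((b - _) * _) => p q; lra.
Qed.

Lemma frequent_invariant b : f @^-1` (frequent b) = frequent b.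
Proof.
by apply/seteqP; split=> x; apply: frequent_close => n; case: (visit_count_shift x n).
Qed.

(** By ergodicity the event is null or full. If it were full, then for some [r] strictly between
    [mu A] and [b] almost every point would have a positive Birkhoff sum of [1_A - r], whence
    [r <= mu A]. *)
Lemma frequent_null b : fine (mu A) < b -> mu (frequent b) = 0%E.
Proof.
move=> ab; case: (f_erg _ (measurable_frequent b) (frequent_invariant b)) => // B1.
exfalso; set a := fine (mu A) in ab.
have [k kab] : exists k : nat, k.+1%:R^-1 < b - a.
  exists (Num.truncn (b - a)^-1).
  rewrite -[ltRHS]invrK ltf_pV2 ?posrE ?invr_gt0 ?subr_gt0//.
  exact: truncnS_gt.
pose b' := b - k.+1%:R^-1; pose r := (a + b') / 2.
have ar : a < r by rewrite /r /b'; move: (k.+1%:R^-1) kab => w; lra.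
have rb : r < b' by rewrite /r /b'; move: (k.+1%:R^-1) kab => w; lra.
have bg : bounded_measurable (fun x => \1_A x - r : R).
  apply: bounded_measurableB; first exact: bounded_measurable_indic.
  exact: bounded_measurable_cst.
suff : 0 <= \int[mu]_x (\1_A x - r).
  rewrite meanB ?mean_indic ?mean_cst//.
  - by rewrite subr_ge0 leNgt ar.
  - exact: bounded_measurable_indic.
  - exact: bounded_measurable_cst.
apply: mean_ge0 => //.
have : {ae mu, forall x, frequent b x}.
  exists (~` frequent b); split => //.
  - by apply: measurableC; exact: measurable_frequent.
  - rewrite probability_setC ?B1 ?subee//; exact: measurable_frequent.
(* Times from 1 on are required, since a positive [n] makes the inequality strict. *)
apply: filterS => x /(_ k 1%N)[n n1 nx]; exists n.
rewrite /birkhoff_sum sumrB sumr_const card_ord subr_gt0 -/(birkhoff_sum \1_A n x).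
rewrite -visit_countE; apply: lt_le_trans nx.
by rewrite -[ltLHS]mulr_natr ltr_pM2r ?ltr0n.
Qed.

End visits.
End ergodic_frequency.
End Birkhoff.

Section Frequency.
Context {d} {T : measurableType d} {R : realType}.
Variables (mu : probability T R) (f : T -> T).
Hypotheses (mf : measurable_fun [set: T] f) (f_inv : invariant_measure mu f).
Hypothesis f_erg : ergodic mu f.

Lemma visit_count_ae_le (A : set T) (b : R) : measurable A -> fine (mu A) < b ->
  {ae mu, forall x, \forall n \near \oo, (visit_count f A x n)%:R <= b * n%:R}.
Proof.
move=> mA ab; exists (frequent f A b); split.
- exact: measurable_frequent.
- by apply: (frequent_null mu f).
move=> x /= nx k N; apply: contrapT => nH; apply: nx.
exists N => // n /= Nn; rewrite leNgt; apply/negP => bn; apply: nH.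
by exists n => //; apply: le_trans (ltW bn); rewrite ler_wpM2r// gerBl invr_ge0.
Qed.

Lemma visit_countC (A : set T) x n :
  (visit_count f A x n + visit_count f (~` A) x n = n)%N.
Proof.
rewrite /visit_count; elim: n => [|n IH]; first by rewrite /hits !big_ord0.
rewrite !hitsS addnACA IH -[RHS]addn1; congr (_ + _)%N.
by rewrite /visits; case: asboolP; case: asboolP.
Qed.

(** Visits to [A] and to its complement add up to [n], so the upper bound for the complement is the
    lower bound for [A]. *)
Lemma visit_frequency (A : set T) : measurable A ->
  {ae mu, forall x,
    (visit_count f A x n)%:R / n%:R @[n --> \oo] --> fine (mu A)}.
Proof.
move=> mA; set a := fine (mu A).
have aC : fine (mu (~` A)) = 1 - a.
  by rewrite probability_setC// fineB//; exact: fin_num_measure.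
have up : {ae mu, forall x k, \forall n \near \oo,
    (visit_count f A x n)%:R <= (a + k.+1%:R^-1) * n%:R}.
  by apply: ae_foralln => k; apply: visit_count_ae_le => //; rewrite ltrDl invr_gt0.
have dn : {ae mu, forall x k, \forall n \near \oo,
    (visit_count f (~` A) x n)%:R <= (1 - a + k.+1%:R^-1) * n%:R}.
  apply: ae_foralln => k; apply: visit_count_ae_le; first exact: measurableC.
  by rewrite aC ltrDl invr_gt0.
apply: filterS2 up dn => x upx dnx.
apply/cvgrPdist_le => eps eps0.
have [k keps] : exists k : nat, k.+1%:R^-1 < eps.
  exists (Num.truncn eps^-1).
  by rewrite -[ltRHS]invrK ltf_pV2 ?posrE ?invr_gt0//; exact: truncnS_gt.
near=> n.
have n0 : 0 < n%:R :> R by rewrite ltr0n; near: n; exact: nbhs_infty_gt.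
have h1 : (visit_count f A x n)%:R <= (a + k.+1%:R^-1) * n%:R by near: n; exact: upx.
have h2 : (visit_count f (~` A) x n)%:R <= (1 - a + k.+1%:R^-1) * n%:R.
  by near: n; exact: dnx.
have h3 : (visit_count f A x n)%:R + (visit_count f (~` A) x n)%:R = n%:R :> R.
  by rewrite -natrD visit_countC.
rewrite distrC ler_distl ler_pdivlMr// ler_pdivrMr//; apply/andP; split.
  have : (1 - a + k.+1%:R^-1) * n%:R <= (1 - a + eps) * n%:R.
    by rewrite ler_pM2r// lerD2l ltW.
  rewrite !mulrDl !mulNr mul1r in h2 *.
  by move: (a * n%:R) (eps * n%:R) (k.+1%:R^-1 * n%:R) h2 h3 => p q r; lra.
apply: le_trans h1 _; rewrite ler_pM2r// lerD2l; exact: ltW.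
Unshelve. all: by end_near. Qed.

Lemma visit_frequency_mean (A : set T) : measurable A ->
  \int[mu]_x `|(visit_count f A x n)%:R / n%:R - fine (mu A)| @[n --> \oo] --> 0.
Proof.
move=> mA; rewrite -[X in _ --> X](mean_cst mu).
have bfreq n : bounded_measurable (fun x =>
    `|(visit_count f A x n)%:R / n%:R - fine (mu A)| : R).
  apply: bounded_measurable_norm; apply: bounded_measurableB.
    apply: bounded_measurableM; first exact: visit_count_bounded.
    exact: bounded_measurable_cst.
  exact: bounded_measurable_cst.
have mA0 : 0 <= fine (mu A) by rewrite fine_ge0.
apply: (mean_cvg mu _ _ (1 + fine (mu A))) => //.
- exact: bounded_measurable_cst.
- move=> n x; rewrite normr_id; apply: le_trans (ler_normB _ _) _.
  rewrite (ger0_norm mA0) lerD2r ger0_norm ?divr_ge0//.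
  case: n => [|n]; first by rewrite invr0 mulr0.
  by rewrite ler_pdivrMr ?ltr0n// mul1r ler_nat hits_le.
apply: filterS (visit_frequency A mA) => x cvgx.
have <- : `|fine (mu A) - fine (mu A)| = 0 by rewrite subrr normr0.
by apply: cvg_norm; apply: cvgB => //; exact: cvg_cst.
Qed.

End Frequency.

(** * Linear growth of the number of visits *)

Section OrbitConsequences.
Context {R : realType}.
Implicit Type y : nat -> bool.

(** The constant [C] absorbs the initial times at which the frequency is not yet close to [a]. This
    makes the bound uniform in time, as needed to compare all atoms of two processes at once. *)
Lemma hits_linear y (a : R) : 0 <= a <= 1 ->
  (hits y n)%:R / n%:R @[n --> \oo] --> a ->
  forall eta, 0 < eta ->
  exists C, forall n, `|(hits y n)%:R - a * n%:R| <= C + eta * n%:R.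
Proof.
move=> /andP[a0 a1] /cvgrPdist_le lim eta eta0.
have [N _ HN] := lim eta eta0.
exists N%:R => n; case: (leqP N n) => [Nn|nN].
  have [->|n0] := posnP n; first by rewrite /hits big_ord0 !mulr0 subr0 normr0 addr0.
  have := HN n Nn; rewrite /= distrC => h.
  have -> : (hits y n)%:R - a * n%:R = ((hits y n)%:R / n%:R - a) * n%:R.
    by rewrite mulrBl divfK// pnatr_eq0 -lt0n.
  rewrite normrM normr_nat; apply: le_trans (_ : eta * n%:R <= _).
    by rewrite ler_wpM2r.
  by rewrite lerDr.
apply: (@le_trans _ _ n%:R); last first.
  by rewrite -[leLHS]addr0 lerD// ?ler_nat 1?ltnW// mulr_ge0// ltW.
have h1 : (hits y n)%:R <= n%:R :> R by rewrite ler_nat hits_le.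
have h2 : a * n%:R <= n%:R by rewrite ler_piMl.
have h3 : 0 <= a * n%:R by rewrite mulr_ge0.
have h0 : 0 <= (hits y n)%:R :> R by [].
rewrite ler_norml; move: (a * n%:R) (hits y n)%:R h0 h1 h2 h3 => p q h0 h1 h2 h3.
by apply/andP; split; lra.
Qed.

Lemma hits_unbounded y (a : R) : 0 < a <= 1 ->
  (hits y n)%:R / n%:R @[n --> \oo] --> a ->
  forall k, is_hit_index y k.
Proof.
move=> /andP[a0 a1] lim k.
have a2 : 0 < a / 2 by lra.
have [|C HC] := hits_linear y a _ lim _ a2; first by rewrite ltW.
pose n := (Num.truncn ((C + k%:R) / (a / 2))).+1.
apply: (@is_hit_index_lt _ n).
rewrite -(ltr_nat R); have := HC n; rewrite ler_distl => /andP[+ _].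
have : (C + k%:R) < a / 2 * n%:R by rewrite mulrC -ltr_pdivrMr// truncnS_gt.
by lra.
Qed.

End OrbitConsequences.

(** * Measurability of the processes *)

Section Measurability.
Context {R : realType}.
Local Notation Mp := (counting_measure R).
Local Notation borelMp := (g_sigma_algebraType [set U : set Mp | open U]).

Lemma measurable_continuous_Mp (Phi : Mp -> R) : continuous Phi ->
  measurable_fun [set: borelMp] (Phi : borelMp -> R).
Proof.
move=> cPhi; apply: (measurability _ (RGenOInfty.measurableE R)).
move=> _ [_ [r ->] <-]; rewrite setTI; apply: sub_sigma_algebra => /=.
by move/continuousP : cPhi; apply; exact: interval_open.
Qed.

(** Otherwise some sequences agreeing with [e] on longer and longer initial segments would give
    configurations outside [U]. These converge vaguely to that of [e], since a test function depends
    on finitely many entries. *)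
Lemma open_exceedance_process (v : R) (U : set Mp) (e : nat -> bool) : 0 < v ->
  open U -> U (exceedance_process v e) ->
  exists n, forall e', (forall i, (i < n)%N -> e' i = e i) ->
    U (exceedance_process v e').
Proof.
move=> v0 oU Ue; apply: contrapT => H.
have {}H n : exists e', (forall i, (i < n)%N -> e' i = e i) /\
    ~ U (exceedance_process v e').
  apply: contrapT => nH; apply: H; exists n => e' e'e; apply: contrapT => nU.
  by apply: nH; exists e'.
have [e_ He] := choice H.
have : exceedance_process v (e_ n) @[n --> \oo] --> exceedance_process v e.
  apply: cvg_vague => psi.
  have [K psiK] : exists K : R, forall t, K < t -> sval psi t = 0.
    by case: (svalP psi).
  pose N := (Num.truncn (v * K)).+1.
  have psi0 e' i : (N <= i)%N -> e' i -> sval psi (i%:R / v) = 0.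
    move=> Ni _; apply: psiK; rewrite ltr_pdivlMr// mulrC.
    by apply: (lt_le_trans (truncnS_gt _)); rewrite ler_nat.
  apply: (@cvg_trans _ ((fun=> vague_eval (exceedance_process v e) psi) @ \oo));
    last exact: cvg_cst.
  apply: near_eq_cvg; near=> n.
  have Nn : (N <= n)%N by near: n; exact: nbhs_infty_ge.
  rewrite !(vague_eval_exceedance _ _ _ N)//; last exact: psi0; last exact: psi0.
  apply: eq_bigl => i /=; have [-> //] := He n.
  exact: leq_trans (ltn_ord i) Nn.
move=> /(_ U); rewrite nbhsE => /(_ (ex_intro2 _ _ U (conj oU Ue) (fun _ => id))).
rewrite nbhs_filterE /= => nearU.
have [n Un] : exists n, U (exceedance_process v (e_ n)).
  exact: (@filter_ex _ \oo _ _ nearU).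
by have [_] := He n.
Unshelve. all: by end_near. Qed.

Context {d} {T : measurableType d}.

(* An open set of configurations is detected on finitely many entries of the
   boolean sequence, so its preimage is a countable union of cylinders, whether or
   not the vague topology has a countable base. *)
Lemma point_process_exceedance (v : R) (e : T -> nat -> bool) :
  (forall j, measurable [set x | e x j]) ->
  point_process (fun x => exceedance_process v (e x)).
Proof.
move=> me; have [v0|nv0] := pselect (0 < v); last first.
  rewrite /exceedance_process; case: pselect => // _; exact: measurable_cst.
rewrite /point_process.
apply: (@measurability _ _ T borelMp setT _ [set U : set Mp | open U]) => //.
move=> _ [U oU <-]; rewrite setTI.
pose S := [set s : seq bool | forall e' : nat -> bool,
  (forall i, (i < size s)%N -> e' i = nth false s i) ->
  U (exceedance_process v e')].
pose C (s : seq bool) := \bigcap_(i in [set i | (i < size s)%N])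
  [set x | e x i = nth false s i].
have -> : (fun x => exceedance_process v (e x)) @^-1` U =
    \bigcup_s (if s \in S then C s else set0).
  apply/seteqP; split=> x /=.
    move=> /(open_exceedance_process _ _ _ v0 oU)[n Hn].
    exists (mkseq (e x) n) => //; rewrite mem_set.
      by move=> i /=; rewrite size_mkseq => ni; rewrite nth_mkseq.
    move=> e'; rewrite size_mkseq => e'e; apply: Hn => i ni.
    by rewrite e'e// nth_mkseq.
  move=> [s _]; case: ifPn => //; rewrite inE => Ss Cx.
  by apply: Ss => i si; exact: Cx.
apply: countable_bigcupT_measurable => [|s]; first exact: countableP.
case: ifP => _ //; apply: bigcap_measurableType => i _.
case: (nth false s i); first exact: me.
rewrite (_ : [set x | _] = ~` [set x | e x i]); first exact: measurableC.
by apply/seteqP; split=> x /=; case: (e x i).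
Qed.

Lemma integral_law (m : probability T R) (Z : T -> Mp) (Phi : Mp -> R) (M : R) :
  point_process Z -> continuous Phi -> (forall z, `|Phi z| <= M) ->
  (\int[law m Z]_z (Phi z)%:E = (\int[m]_x Phi (Z x))%:E)%E /\
  bounded_measurable (Phi \o Z).
Proof.
move=> mZ cPhi PhiM.
have mPhi := measurable_continuous_Mp Phi cPhi.
have bPhiZ : bounded_measurable (Phi \o Z).
  split; last by exists M => x; exact: PhiM.
  exact: (measurableT_comp mPhi mZ).
split => //; rewrite /law.
have mEPhi : measurable_fun [set: borelMp] (fun z : borelMp => (Phi z)%:E).
  exact/measurable_EFinP.
have intPhiZ := bounded_measurable_integrable m _ bPhiZ.
rewrite (integral_pushforward mZ mEPhi)// preimage_setT.
by rewrite /Rintegral fineK//; exact: integrable_fin_num.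
Qed.

Variable f : T -> T.
Hypothesis mf : measurable_fun [set: T] f.

Lemma measurable_first_return_map (Y : set T) : measurable Y ->
  measurable_fun [set: T] (first_return_map f Y).
Proof.
move=> mY _ B mB; rewrite setTI.
have mYn n : measurable (iter n f @^-1` Y).
  by rewrite -[X in measurable X]setTI; exact: measurable_iter.
(* The level sets of the return time; by its default value, level 0 is the event of no return. *)
pose W n := if n is 0%N then \bigcap_k ~` (iter k.+1 f @^-1` Y)
  else iter n f @^-1` Y `&`
    \bigcap_(k in [set k | (k < n.-1)%N]) ~` (iter k.+1 f @^-1` Y).
have WE n : W n = [set x | first_return_time f Y x = n].
  apply/seteqP; split=> x /=; rewrite /first_return_time.
    case: pselect => [h|nh]; case: n => [|n] //=.
    - move=> Hx; have [m /andP[m0 /asboolP Ym]] := h.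
      by case: m m0 Ym => // m _ Ym; have := Hx m I.
    - move=> [Yn Hx]; case: ex_minnP => m /andP[m0 /asboolP Ym] minm.
      apply/eqP; rewrite eqn_leq minm/=; last by apply/asboolP.
      rewrite leqNgt; apply/negP => mn; case: m m0 Ym mn {minm} => // m _ Ym mn.
      by have := Hx m mn.
    - by move=> [Yn _]; exfalso; apply: nh; exists n.+1; apply/asboolP.
  case: pselect => [h|nh] => [|<- k _ /= Yk]; last first.
    by apply: nh; exists k.+1; apply/asboolP.
  case: ex_minnP => m /andP[m0 /asboolP Ym] minm <-; case: m m0 Ym minm => // m _ Ym minm.
  split => // k /= km Yk.
  have /minm : (0 < k.+1)%N && `[< Y (iter k.+1 f x) >] by apply/asboolP.
  by rewrite ltnS leqNgt km.
have -> : first_return_map f Y @^-1` B = \bigcup_n (W n `&` iter n f @^-1` B).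
  apply/seteqP; split=> [x Bx|x [n _ []]].
    by exists (first_return_time f Y x) => //; split => //; rewrite WE.
  by rewrite WE /= => <-.
apply: bigcupT_measurable => n; apply: measurableI.
  case: n => [|n].
    by apply: bigcapT_measurable => k; exact: measurableC.
  apply: measurableI => //; apply: bigcap_measurableType => k _.
  exact: measurableC.
by rewrite -[X in measurable X]setTI; exact: measurable_iter.
Qed.

End Measurability.

(** * Tightness *)

Section RareEventProbability.
Context {d} {T : measurableType d} {R : realType}.
Variables (mu : probability T R).

(** The bad sets [B n] may vary with [n]. On them [D n] is at most [M] and contributes little; off
    them it tends to 0 almost everywhere and dominated convergence applies. *)
Lemma mean_vanish (D : nat -> T -> R) (M : R) :
  (forall n, bounded_measurable (D n)) -> (forall n x, 0 <= D n x <= M) ->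
  (forall eps, 0 < eps -> exists B : nat -> set T,
    [/\ forall n, measurable (B n),
        \forall n \near \oo, fine (mu (B n)) <= eps &
        {ae mu, forall x, forall r, 0 < r ->
          \forall n \near \oo, ~ B n x -> D n x < r}]) ->
  \int[mu]_x D n x @[n --> \oo] --> 0.
Proof.
move=> bD DM HB; apply/cvgr0Pnorm_le => eps eps0.
have M1 : 0 < `|M| + 1 by rewrite ltr_wpDl.
have [|B [mB muB DB]] := HB (eps / (2 * (`|M| + 1))).
  by rewrite divr_gt0// mulr_gt0.
have bC n : bounded_measurable (\1_(~` B n) : T -> R).
  by apply: bounded_measurable_indic; exact: measurableC.
have bB n : bounded_measurable (\1_(B n) : T -> R) by exact: bounded_measurable_indic.
have small : \int[mu]_x (D n x * \1_(~` B n) x) @[n --> \oo] --> 0.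
  rewrite -[X in _ --> X](mean_cst mu).
  apply: (mean_cvg mu _ _ M) => //.
  - by move=> n; exact: bounded_measurableM.
  - exact: bounded_measurable_cst.
  - move=> n x; have /andP[D0 DMx] := DM n x.
    rewrite ger0_norm ?mulr_ge0//; apply: le_trans DMx.
    by rewrite ler_piMr// indicE lern1 leq_b1.
  apply: filterS DB => x Dx; apply/cvgr0Pnorm_lt => r r0.
  apply: filterS (Dx r r0) => n nB; have /andP[D0 _] := DM n x.
  rewrite ger0_norm ?mulr_ge0// indicE.
  case: (boolP (x \in ~` B n)); last by rewrite mulr0.
  by rewrite inE mulr1 => /nB.
have eps2 : 0 < eps / 2 by rewrite divr_gt0.
near=> n.
have Dn0 : 0 <= \int[mu]_x D n x.
  by apply: Rintegral_ge0 => x _; have /andP[] := DM n x.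
rewrite ger0_norm//.
have -> : eps = (`|M| + 1) * (eps / (2 * (`|M| + 1))) + eps / 2.
  by field; rewrite gt_eqF.
apply: (@le_trans _ _ (\int[mu]_x ((`|M| + 1) * \1_(B n) x + D n x * \1_(~` B n) x))).
  apply: le_mean => //.
    apply: bounded_measurableD; last exact: bounded_measurableM.
    by apply: bounded_measurableM => //; exact: bounded_measurable_cst.
  move=> x; have /andP[D0 DMx] := DM n x; rewrite !indicE in_setC.
  case: (x \in B n) => /=; rewrite ?mulr0 ?mulr1 ?addr0 ?add0r//.
  by apply: (le_trans DMx); rewrite -[leLHS]addr0 lerD// ler_norm.
have bMB : bounded_measurable (fun x => (`|M| + 1) * \1_(B n) x : R).
  by apply: bounded_measurableM => //; exact: bounded_measurable_cst.
rewrite meanD//; last exact: bounded_measurableM.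
rewrite meanZ// mean_indic//; apply: lerD.
  by apply: ler_wpM2l; [exact: ltW|near: n; exact: muB].
apply: le_trans (ler_norm _) _; near: n.
by move/cvgr0Pnorm_le : small; exact.
Unshelve. all: by end_near. Qed.

Variable f : T -> T.
Hypotheses (mf : measurable_fun [set: T] f) (f_inv : invariant_measure mu f).

Lemma mean_visit_count (A : set T) n : measurable A ->
  \int[mu]_x (visit_count f A x n)%:R = n%:R * fine (mu A).
Proof.
move=> mA; under eq_Rintegral do rewrite visit_countE.
have bA i : bounded_measurable (fun x => \1_A (iter i f x) : R).
  apply: (bounded_measurable_comp (iter i f)); first exact: measurable_iter.
  exact: bounded_measurable_indic.
rewrite (mean_sum mu _ n bA) (eq_bigr (fun=> fine (mu A))).
  by rewrite sumr_const card_ord mulr_natl.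
move=> i _; elim: (i : nat) => [|j IH] /=; first exact: mean_indic.
rewrite -IH -(mean_comp mu f (fun x => \1_A (iter j f x)))//.
by apply: eq_Rintegral => x _; rewrite -iterSr.
Qed.

Lemma measurable_visit_count_gt (B : set T) c n : measurable B ->
  measurable [set x | (c < visit_count f B x n)%N].
Proof.
move=> mB.
rewrite (_ : [set x | _] = [set x | c%:R < (visit_count f B x n)%:R :> R]); last first.
  by apply/seteqP; split=> x /=; rewrite ltr_nat.
rewrite -[X in measurable X]setTI; apply: measurable_fun_ltr => //.
by case: (visit_count_bounded (R := R) f mf B mB n).
Qed.

(** Markov's inequality for an integer-valued count. *)
Lemma visit_count_tail (A : set T) n c : measurable A ->
  c.+1%:R * fine (mu [set x | (c < visit_count f A x n)%N]) <= n%:R * fine (mu A).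
Proof.
move=> mA; set B := [set x | _].
have mB : measurable B by exact: measurable_visit_count_gt.
rewrite -(mean_visit_count A)// -mean_indic// -meanZ;
  last exact: bounded_measurable_indic.
apply: le_mean.
- apply: bounded_measurableM; first exact: bounded_measurable_cst.
  exact: bounded_measurable_indic.
- exact: visit_count_bounded.
move=> x; rewrite indicE; case: (boolP (x \in B)); last by rewrite mulr0.
by rewrite inE mulr1 ler_nat.
Qed.

Section crowded.
Variable A : nat -> set T.
Hypothesis mA : forall n, measurable (A n).
Local Notation p n := (fine (mu (A n))).

(* Some interval [0, m] carries more than [c m] atoms of the rare event process
   with exceedance set [A n]. *)
Definition crowded (c : nat -> nat) n : set T :=
  \bigcup_m [set x | (c m < visit_count f (A n) x (Num.truncn ((p n)^-1 * m%:R)).+1)%N].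

Lemma measurable_crowded c n : measurable (crowded c n).
Proof.
by apply: bigcupT_measurable => m; exact: measurable_visit_count_gt.
Qed.

(** The mean number of atoms in [[0, m]] is at most [m + 1] whatever [n] is, so by Markov's
    inequality a [c m] independent of [n] makes the [m]-th event of probability at most
    [eps / 2 ^ (m + 1)]. These bounds sum to [eps]. *)
Lemma crowded_small eps : 0 < eps ->
  exists c, forall n, 0 < p n -> fine (mu (crowded c n)) <= eps.
Proof.
move=> eps0; pose c m := Num.truncn (m.+1%:R / (eps / (2 ^ m.+1)%:R)).
exists c => n pn0.
rewrite -lee_fin fineK; last by apply: fin_num_measure; exact: measurable_crowded.
pose k m := (Num.truncn ((p n)^-1 * m%:R)).+1.
pose B m := [set x | (c m < visit_count f (A n) x (k m))%N].
have mB m : measurable (B m) by exact: measurable_visit_count_gt.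
have sub : (mu (crowded c n) <= \sum_(m <oo) mu (B m))%E.
  by apply: measure_sigma_subadditive => //; exact: measurable_crowded.
apply: (le_trans sub); apply: le_trans (epsilon_trick0 xpredT (ltW eps0)).
apply: lee_nneseries => // m _.
rewrite -[leLHS]fineK ?fin_num_measure// lee_fin.
(* Rounding up adds at most one time, hence at most [p n <= 1] to the mean. *)
have kp : (k m)%:R * p n <= m.+1%:R.
  have k1 : (k m)%:R <= (p n)^-1 * m%:R + 1.
    rewrite /k -natr1 lerD2r truncn_le.
    by rewrite mulr_ge0// invr_ge0 ltW.
  apply: (@le_trans _ _ (((p n)^-1 * m%:R + 1) * p n)); first by rewrite ler_wpM2r// ltW.
  rewrite mulrDl mulrAC mulVf ?gt_eqF// !mul1r -natr1 lerD2l.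
  by rewrite -lee_fin fineK ?fin_num_measure//; exact: probability_le1.
have := le_trans (visit_count_tail (A n) (k m) (c m) (mA n)) kp.
rewrite -/(B m) mulrC -ler_pdivlMr ?ltr0n// => /le_trans; apply.
have e0 : 0 < eps / (2 ^ m.+1)%:R by rewrite divr_gt0// ltr0n expn_gt0.
rewrite ler_pdivrMr ?ltr0n// mulrC -ler_pdivrMr//.
exact/ltW/truncnS_gt.
Qed.

End crowded.
End RareEventProbability.

(** * Passing between the invariant and the induced measure *)

Section InducedMean.
Context {d} {T : measurableType d} {R : realType}.
Variables (mu : probability T R) (Y : set T) (mY : measurable Y).
Hypothesis Y0 : (0 < mu Y)%E.

Lemma fine_gt0_measure : 0 < fine (mu Y).
Proof. by rewrite fine_gt0// Y0 ltey_eq fin_num_measure. Qed.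

Lemma fine_induced_measure (A : set T) : measurable A ->
  fine (induced_measure mu mY A) = fine (mu (A `&` Y)) / fine (mu Y).
Proof.
move=> mA; rewrite induced_measureE// -[in LHS](fineK (fin_num_measure mu _ mY)).
rewrite -[in LHS](fineK (fin_num_measure mu (A `&` Y) _)); last exact: measurableI.
by rewrite inver gt_eqF ?fine_gt0_measure.
Qed.

(** For nonnegative functions, the complement of [Y] is null for the induced measure, which on [Y]
    is a multiple of [mu]. Adding a bound [M] reduces the general case to this one. *)
Lemma mean_induced (g : T -> R) : bounded_measurable g ->
  \int[induced_measure mu mY]_x g x =
  (fine (mu Y))^-1 * \int[mu]_x (\1_Y x * g x).
Proof.
set nu := induced_measure mu mY; set a := fine (mu Y).
have a0 : 0 < a by exact: fine_gt0_measure.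
have bY : bounded_measurable (\1_Y : T -> R) by exact: bounded_measurable_indic.
have pos h : bounded_measurable h -> (forall x, 0 <= h x) ->
    \int[nu]_x h x = a^-1 * \int[mu]_x (\1_Y x * h x).
  move=> bh h0; have mh : measurable_fun [set: T] (EFin \o h).
    by apply/measurable_EFinP; case: bh.
  have ia : 0 <= a^-1 by rewrite invr_ge0 ltW.
  have -> : \int[nu]_x h x = fine (\int[mscale (NngNum ia) mu]_(x in Y) (h x)%:E)%E.
    congr fine; have mYc : measurable (~` Y) by exact: measurableC.
    have nuYc : nu (~` Y) = 0%E.
      by rewrite /nu induced_measureE// setICl measure0 mul0e.
    have h0' x : [set: T] x -> (0 <= (h x)%:E)%E by rewrite lee_fin.
    rewrite (ge0_negligible_integral mYc measurableT mh h0' nuYc) setTD setCK.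
    apply: eq_measure_integral => A mA AY.
    transitivity (mu (A `&` Y) / mu Y)%E; first exact: induced_measureE.
    have /setIidPl -> := AY; transitivity (a^-1%:E * mu A)%E => //.
    rewrite muleC -[in LHS](fineK (fin_num_measure mu _ mY)).
    by rewrite inver gt_eqF.
  rewrite ge0_integral_mscale//=; last 2 first.
    by apply: measurable_funTS.
    by move=> x _; rewrite lee_fin.
  rewrite fineM//; last first.
    apply: integrable_fin_num => //; apply: (integrableS measurableT) => //.
    exact: bounded_measurable_integrable.
  transitivity (a^-1 * \int[mu]_(x in Y) h x) => //.
  congr (_ * _); rewrite Rintegral_mkcond; apply: eq_Rintegral => x _.
  rewrite patchE indicE; case: (x \in Y); first by rewrite mul1r.
  by rewrite mul0r.
move=> bg; have [M gM] := bg.2.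
have bM : bounded_measurable (cst M : T -> R) by exact: bounded_measurable_cst.
have := pos (fun x => g x + M) (bounded_measurableD _ _ bg bM).
rewrite meanD// mean_cst => E.
have bYg : bounded_measurable (fun x => \1_Y x * g x : R) by exact: bounded_measurableM.
have bMY : bounded_measurable (fun x => M * \1_Y x : R) by exact: bounded_measurableM.
have : \int[nu]_x g x + M = a^-1 * (\int[mu]_x (\1_Y x * g x) + M * a).
  rewrite E; last by move=> x; have := gM x; rewrite ler_norml => /andP[]; lra.
  congr (_ * _); rewrite -[a](mean_indic mu)// -meanZ// -meanD//.
  by apply: eq_Rintegral => x _; rewrite mulrDr [_ * M]mulrC.
rewrite mulrDr [_ * (M * a)]mulrCA mulVf ?gt_eqF// mulr1.
by move/addIr.
Qed.

End InducedMean.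

(** * Asymptotic invariance and decorrelation from a fixed set *)

Section AsymptoticInvariance.
Context {d} {T : measurableType d} {R : realType}.
Variables (mu : probability T R) (f : T -> T).
Hypotheses (mf : measurable_fun [set: T] f) (f_inv : invariant_measure mu f).
Hypothesis f_erg : ergodic mu f.
Variables (Psi : nat -> T -> R) (M : R).
Hypothesis bPsi : forall n, bounded_measurable (Psi n).
Hypothesis PsiM : forall n x, `|Psi n x| <= M.
Hypothesis Psi_shift : \int[mu]_x `|Psi n (f x) - Psi n x| @[n --> \oo] --> 0.

Let M0 : 0 <= M.
Proof. exact: le_trans (PsiM 0 point). Qed.

(** By invariance, composing both factors with [f] preserves the mean, and [Psi n o f] may then be
    replaced by [Psi n] because [g] is bounded. Each of the [k] steps costs an error tending to
    0. *)
Lemma mean_shift_cvg (g : T -> R) k : bounded_measurable g ->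
  (\int[mu]_x (g x * Psi n x) - \int[mu]_x (g (iter k f x) * Psi n x))
    @[n --> \oo] --> 0.
Proof.
move=> bg; elim: k => [|k IH].
  by under eq_fun do rewrite subrr; exact: cvg_cst.
have bgk j : bounded_measurable (fun x => g (iter j f x)).
  by apply: (bounded_measurable_comp (iter j f)) => //; exact: measurable_iter.
have bPf n : bounded_measurable (fun x => Psi n (f x)).
  exact: (bounded_measurable_comp f).
have b1 n : bounded_measurable (fun x => g (iter k f (f x)) * Psi n (f x)).
  by apply: bounded_measurableM => //; exact: (bounded_measurable_comp f _ mf (bgk k)).
have b2 n : bounded_measurable (fun x => g (iter k.+1 f x) * Psi n x).
  exact: bounded_measurableM.
have b3 n : bounded_measurable (fun x => `|Psi n (f x) - Psi n x|).
  by apply: bounded_measurable_norm; exact: bounded_measurableB.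
have step : (\int[mu]_x (g (iter k f x) * Psi n x) -
    \int[mu]_x (g (iter k.+1 f x) * Psi n x)) @[n --> \oo] --> 0.
  have [K gK] := bg.2.
  have K0 : 0 <= K by exact: le_trans (gK point).
  apply/cvgr0Pnorm_le => eps eps0.
  have eK : 0 < eps / (K + 1) by rewrite divr_gt0// ltr_wpDl.
  move/cvgr0Pnorm_le : Psi_shift => /(_ _ eK); apply: filterS => n.
  rewrite ger0_norm; last by apply: Rintegral_ge0 => x _.
  rewrite ler_pdivlMr ?ltr_wpDl// mulrC => /(le_trans _); apply.
  rewrite -(mean_comp mu f (fun x => g (iter k f x) * Psi n x))//; last first.
    exact: bounded_measurableM.
  rewrite -(meanB mu _ _ (b1 n) (b2 n)) -(meanZ mu _ _ (b3 n)).
  have b12 := bounded_measurableB _ _ (b1 n) (b2 n).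
  apply: le_trans (le_norm_mean mu _ b12) _; apply: le_mean.
  - exact: bounded_measurable_norm.
  - by apply: bounded_measurableM => //; exact: bounded_measurable_cst.
  move=> x; rewrite -iterSr -mulrBr normrM ler_wpM2r//.
  by apply: le_trans (gK _) _; rewrite lerDl.
rewrite -[X in _ --> X]addr0; under eq_fun => n do
  rewrite -(subrKA (\int[mu]_x (g (iter k f x) * Psi n x))).
exact: cvgD.
Qed.

(** The centred indicator is replaced by its average along [m] iterates, at a cost tending to 0 with
    [n]; as [Psi n] is bounded by [M], what remains is small uniformly in [n] by the ergodic
    theorem. *)
Lemma mean_decorrelation (A : set T) : measurable A ->
  (\int[mu]_x (\1_A x * Psi n x) - fine (mu A) * \int[mu]_x Psi n x)
    @[n --> \oo] --> 0.
Proof.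
move=> mA; set a := fine (mu A); pose g x : R := \1_A x - a.
have bA : bounded_measurable (\1_A : T -> R) by exact: bounded_measurable_indic.
have ba : bounded_measurable (cst a : T -> R) by exact: bounded_measurable_cst.
have bg : bounded_measurable g by exact: bounded_measurableB.
have bgk j : bounded_measurable (fun x => g (iter j f x)).
  by apply: (bounded_measurable_comp (iter j f)) => //; exact: measurable_iter.
have gE n : \int[mu]_x (\1_A x * Psi n x) - a * \int[mu]_x Psi n x =
    \int[mu]_x (g x * Psi n x).
  rewrite -meanZ// -meanB; [|exact: bounded_measurableM|exact: bounded_measurableM].
  by apply: eq_Rintegral => x _; rewrite -mulrBl.
under eq_fun do rewrite gE.
apply/cvgr0Pnorm_le => eps eps0.
have M1 : 0 < M + 1 by rewrite ltr_wpDl.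
have e1 : 0 < eps / 2 / (M + 1) by rewrite !divr_gt0.
have := visit_frequency_mean mu f mf f_inv f_erg A mA.
move/cvgr0Pnorm_le => /(_ _ e1) [m0 _ Hm0].
(* The length [m] is fixed before [n]; being a successor, it can be divided by. *)
pose m := m0.+1; have {Hm0} := Hm0 m (leqnSn m0); rewrite /= ger0_norm; last first.
  by apply: Rintegral_ge0 => x _.
rewrite ler_pdivlMr// mulrC => freq.
have avgE n : \int[mu]_x (((visit_count f A x m)%:R / m%:R - a) * Psi n x) =
    m%:R^-1 * \sum_(k < m) \int[mu]_x (g (iter k f x) * Psi n x).
  rewrite -(mean_sum mu (fun k x => g (iter k f x) * Psi n x)); last first.
    by move=> i; exact: bounded_measurableM.
  rewrite -meanZ; last first.
    by apply: (bounded_measurable_sum (fun k x => g (iter k f x) * Psi n x)) => i;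
      exact: bounded_measurableM.
  apply: eq_Rintegral => x _; rewrite -mulr_suml mulrA; congr (_ * _).
  rewrite /g sumrB sumr_const card_ord -/(birkhoff_sum f \1_A m x) -visit_countE.
  by rewrite mulrBr -[a *+ m]mulr_natl mulKf ?pnatr_eq0// mulrC.
have bfreq : bounded_measurable (fun x => (visit_count f A x m)%:R / m%:R - a : R).
  apply: bounded_measurableB => //.
  apply: bounded_measurableM; first exact: visit_count_bounded.
  exact: bounded_measurable_cst.
have avg_small n :
    `|\int[mu]_x (((visit_count f A x m)%:R / m%:R - a) * Psi n x)| <= eps / 2.
  apply: le_trans freq; apply: le_trans (le_norm_mean mu _ _) _.
    exact: bounded_measurableM.
  rewrite -meanZ; last exact: bounded_measurable_norm.
  apply: le_mean.
  - by apply: bounded_measurable_norm; exact: bounded_measurableM.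
  - apply: bounded_measurableM; first exact: bounded_measurable_cst.
    exact: bounded_measurable_norm.
  move=> x; rewrite normrM mulrC ler_wpM2r//; apply: le_trans (PsiM n x) _.
  by rewrite lerDl.
have sum0 j : (\sum_(k < j) (\int[mu]_x (g x * Psi n x) -
    \int[mu]_x (g (iter k f x) * Psi n x))) @[n --> \oo] --> 0.
  elim: j => [|j IH].
    by under eq_fun do rewrite big_ord0; exact: cvg_cst.
  rewrite -[X in _ --> X]addr0; under eq_fun do rewrite big_ord_recr/=.
  by apply: cvgD => //; exact: mean_shift_cvg.
have : (m%:R^-1 * \sum_(k < m) (\int[mu]_x (g x * Psi n x) -
    \int[mu]_x (g (iter k f x) * Psi n x))) @[n --> \oo] --> (m%:R^-1 * 0 : R).
  by apply: cvgM; [exact: cvg_cst|exact: sum0].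
rewrite mulr0.
have eps2 : 0 < eps / 2 by rewrite divr_gt0.
move/cvgr0Pnorm_le => /(_ _ eps2); apply: filterS => n.
set q := \int[mu]_x (g x * Psi n x).
rewrite sumrB sumr_const card_ord mulrBr -[q *+ m]mulr_natl mulKf ?pnatr_eq0//.
rewrite -avgE => h; have := avg_small n.
set p := \int[mu]_x _ in h * => hp.
have -> : q = (q - p) + p by rewrite subrK.
apply: le_trans (ler_normD _ _) _; lra.
Qed.

End AsymptoticInvariance.

(** * Rare event processes *)

Section RareEvents.
Context {R : realType} {d} {T : measurableType d}.
Local Notation Mp := (counting_measure R).
Variables (mu : probability T R) (f : T -> T).
Hypotheses (mf : measurable_fun [set: T] f) (f_inv : invariant_measure mu f).
Hypothesis f_erg : ergodic mu f.
Variables (phi : T -> \bar R) (mphi : measurable_fun [set: T] phi).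
Variable u : nat -> R.

Definition exceedance_set n : set T := [set x | ((u n)%:E < phi x)%E].
Local Notation U := exceedance_set.
Local Notation p n := (fine (mu (U n))).

Lemma measurable_exceedance_set n : measurable (U n).
Proof.
by rewrite /U -[X in measurable X]setTI; exact: emeasurable_fun_o_infty.
Qed.

Lemma rare_event_point_process (m : probability T R) (g : T -> T) n :
  measurable_fun [set: T] g ->
  point_process (rare_event_process m g phi (u n)).
Proof.
move=> mg; apply: point_process_exceedance => j.
rewrite -[X in measurable X]setTI.
exact: (measurable_iter _ mg j measurableT _ (measurable_exceedance_set n)).
Qed.

Definition exceeds (g : T -> T) n (x : T) (j : nat) : bool :=
  ((u n)%:E < phi (iter j g x))%E.

Lemma hits_exceeds n x k : hits (exceeds f n x) k = visit_count f (U n) x k.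
Proof.
rewrite /visit_count; congr hits; apply/funext => i.
by rewrite /visits /U /= asboolb.
Qed.

Lemma not_crowded c n x : ~ crowded mu f U c n x ->
  forall m, (hits (exceeds f n x) (Num.truncn ((p n)^-1 * m%:R)).+1 <= c m)%N.
Proof.
move=> nc m; rewrite leqNgt hits_exceeds; apply/negP => cm.
by apply: nc; exists m.
Qed.

Hypothesis p0 : p n @[n --> \oo] --> 0.
Hypothesis p_gt0 : \forall n \near \oo, 0 < p n.

Variables (Phi : Mp -> R) (M : R).
Hypotheses (cPhi : continuous Phi) (PhiM : forall z, `|Phi z| <= M).

Let N n := rare_event_process mu f phi (u n).

Lemma rare_event_bounded (m : probability T R) (g : T -> T) n :
  measurable_fun [set: T] g ->
  bounded_measurable (fun x => Phi (rare_event_process m g phi (u n) x)).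
Proof.
move=> mg; have pp := rare_event_point_process m _ n mg.
by have [] := integral_law m _ _ M pp cPhi PhiM.
Qed.

Let dist_le (a b : R) : `|a| <= M -> `|b| <= M -> `|a - b| <= M + M.
Proof. by move=> aM bM; apply: le_trans (ler_normB _ _) _; exact: lerD. Qed.

(** Passing from [x] to [f x] moves each atom by [p n], which tends to 0, except that an atom at
    time 0 is lost. Hence the bad set contains [U n] besides the crowded points. *)
Lemma rare_event_shift :
  \int[mu]_x `|Phi (N n (f x)) - Phi (N n x)| @[n --> \oo] --> 0.
Proof.
have bN n := rare_event_bounded mu f n mf.
apply: (mean_vanish mu _ (M + M)) => [n|n x|eps eps0].
- apply: bounded_measurable_norm; apply: bounded_measurableB (bN n).
  exact: (bounded_measurable_comp f _ mf (bN n)).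
- by rewrite normr_ge0/=; apply: dist_le.
have eps2 : 0 < eps / 2 by rewrite divr_gt0.
have [c cP] := crowded_small mu f mf f_inv U measurable_exceedance_set _ eps2.
have mcr n : measurable (crowded mu f U c n).
  by apply: measurable_crowded => //; exact: measurable_exceedance_set.
exists (fun n => crowded mu f U c n `|` U n); split.
- by move=> n; apply: measurableU => //; exact: measurable_exceedance_set.
- near=> n; have pn0 : 0 < p n by near: n.
  apply: (@le_trans _ _ (fine (mu (crowded mu f U c n)) + p n)).
    rewrite -fineD ?fin_num_measure//; last exact: measurable_exceedance_set.
    rewrite fine_le ?fin_numD ?fin_num_measure//.
    + by apply: measurableU => //; exact: measurable_exceedance_set.
    + exact: measurable_exceedance_set.
    + by apply: measureU2 => //; exact: measurable_exceedance_set.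
  rewrite [leRHS](splitr eps) lerD//; first exact: cP.
  by near: n; apply: (cvgr_le (0 : R)).
apply: aeW => x r r0.
pose S := [set n | [/\ 0 < p n, ~ crowded mu f U c n x & ~ U n x]].
have close := close_configurations Phi cPhi S (fun n => exceeds f n x)
  (fun n => (p n)^-1) c (fun n i => i.-1%:R / (p n)^-1) (N ^~ x) (fun n => N n (f x)).
have : \forall n \near \oo, S n -> `|Phi (N n x) - Phi (N n (f x))| < r.
  apply: close => //.
  - by move=> n [pn _ _]; rewrite invr_gt0.
  - by move=> n [_ nc _]; exact: not_crowded.
  - by move=> n [pn _ _] i; rewrite invrK mulr_ge0// ltW.
  - move=> eta eta0; near=> n => -[pn _ Ux] i ei; rewrite !invrK -mulrBl.
    case: i ei => [|i] ei; first by case: (Ux).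
    rewrite -[i.+1%:R]natr1 opprD addrA subrr add0r mulN1r normrN gtr0_norm//.
    apply: (@le_trans _ _ eta); first by near: n; apply: (cvgr_le (0 : R)).
    by rewrite ler_peMr ?(ltW eta0)// lerDl mulr_ge0// ?(ltW pn)// addr_ge0.
  - move=> n [pn _ _] psi n0 psi0; apply: vague_eval_exceedance => //.
    by rewrite invr_gt0.
  - move=> n [pn _ Ux] psi n0 psi0.
    rewrite -(vague_eval_exceedance_shift _ (exceeds f n x)) ?invr_gt0//; last exact/negP.
    congr (vague_eval (exceedance_process _ _) _).
    by apply/funext => j; rewrite /exceeds iterSr.
move=> near1; near=> n => nB; rewrite distrC.
have nearS : S n -> `|Phi (N n x) - Phi (N n (f x))| < r by near: n.
apply: nearS; split; first by near: n.
- by move=> cx; apply: nB; left.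
- by move=> Ux; apply: nB; right.
Unshelve. all: by end_near. Qed.

Variables (Y : set T) (mY : measurable Y).
Hypothesis Y0 : (0 < mu Y)%E.
Hypothesis UY : \forall n \near \oo, U n `<=` Y.

Let NY n := rare_event_process (induced_measure mu mY)
  (first_return_map f Y) phi (u n).

(** With [a = mu Y], the exceedance at time [i] has its atom at [i * p n] in one process and at
    [hits y i * p n / a] in the other. The visit frequency bounds their distance for almost every
    starting point in [Y]. *)
Lemma rare_event_induced :
  \int[mu]_x (\1_Y x * `|Phi (N n x) - Phi (NY n x)|) @[n --> \oo] --> 0.
Proof.
set a := fine (mu Y).
have a01 : 0 < a <= 1.
  rewrite fine_gt0_measure//= -lee_fin fineK ?fin_num_measure//.
  exact: probability_le1.
have /andP[a0 a1] := a01.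
have bN n := rare_event_bounded mu f n mf.
have bNY n := rare_event_bounded (induced_measure mu mY) _ n
  (measurable_first_return_map f mf Y mY).
apply: (mean_vanish mu _ (M + M)) => [n|n x|eps eps0].
- apply: bounded_measurableM; first exact: bounded_measurable_indic.
  by apply: bounded_measurable_norm; exact: bounded_measurableB (bN n) (bNY n).
- rewrite mulr_ge0//=; apply: le_trans (dist_le _ _ (PhiM (N n x)) (PhiM (NY n x))).
  by rewrite ler_piMl// indicE lern1 leq_b1.
have [c cP] := crowded_small mu f mf f_inv U measurable_exceedance_set _ eps0.
exists (fun n => crowded mu f U c n); split.
- by move=> n; apply: measurable_crowded => //; exact: measurable_exceedance_set.
- by apply: filterS p_gt0 => n; exact: cP.
apply: filterS (visit_frequency mu f mf f_inv f_erg Y mY) => x freq r r0.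
have [Yx|nYx] := pselect (Y x); last first.
  by apply: nearW => n _; rewrite indicE memNset// mul0r.
pose S := [set n | [/\ 0 < p n, ~ crowded mu f U c n x & U n `<=` Y]].
pose y := visits f Y x.
have yk k : is_hit_index y k by exact: hits_unbounded a01 freq k.
have vY n : U n `<=` Y -> fine (induced_measure mu mY (U n)) = p n / a.
  move=> UnY; rewrite fine_induced_measure//; last exact: measurable_exceedance_set.
  by have /setIidPl -> := UnY.
have close := close_configurations Phi cPhi S (fun n => exceeds f n x)
  (fun n => (p n)^-1) c (fun n i => (hits y i)%:R / (p n / a)^-1) (N ^~ x) (NY ^~ x).
have : \forall n \near \oo, S n -> `|Phi (N n x) - Phi (NY n x)| < r.
  apply: close => //.
  - by move=> n [pn _ _]; rewrite invr_gt0.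
  - by move=> n [_ nc _]; exact: not_crowded.
  - by move=> n [pn _ _] i; rewrite invrK mulr_ge0// divr_ge0// ltW.
  - move=> eta eta0.
    (* The factor [a] compensates the division by [a] in the induced scale; the constant term
       [p n * C / a] is then eventually below [eta]. *)
    have eta0' : 0 < eta * a by rewrite mulr_gt0.
    have a01' : 0 <= a <= 1 by rewrite a1 ltW.
    have [C HC] := hits_linear y a a01' freq _ eta0'.
    have pC : p n * C @[n --> \oo] --> 0.
      by rewrite -[X in _ --> X](mul0r C); apply: cvgM => //; exact: cvg_cst.
    near=> n => -[pn _ _] i ei; rewrite !invrK.
    have -> : (hits y i)%:R * (p n / a) - i%:R * p n =
        p n / a * ((hits y i)%:R - a * i%:R).
      by field; rewrite gt_eqF.
    rewrite normrM gtr0_norm ?divr_gt0// mulrAC ler_pdivrMr//.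
    apply: (@le_trans _ _ (p n * (C + eta * a * i%:R))).
      by rewrite ler_wpM2l// ltW.
    have pnC : p n * C <= eta * a by near: n; apply: (cvgr_le (0 : R)).
    have -> : eta * (1 + i%:R * p n) * a = eta * a + p n * (eta * a * i%:R) by ring.
    by rewrite mulrDr lerD2r.
  - move=> n [pn _ _] psi n0 psi0; apply: vague_eval_exceedance => //.
    by rewrite invr_gt0.
  - move=> n [pn _ UnY] psi n0 psi0.
    rewrite -(vague_eval_exceedance_hits _ (exceeds f n x) y) ?invr_gt0 ?divr_gt0//.
      rewrite /NY /rare_event_process -/(U n) vY//.
      congr (vague_eval (exceedance_process _ _) _).
      apply/funext => j; rewrite /exceeds (iter_first_return_map f Y x)//.
      exact/asboolP.
    by move=> i ei; apply/asboolP; exact: UnY.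
move=> near1; near=> n => nB; rewrite indicE mem_set// mul1r.
have nearS : S n -> `|Phi (N n x) - Phi (NY n x)| < r by near: n.
by apply: nearS; split=> //; near: n.
Unshelve. all: by end_near. Qed.

(** The induced mean is a mean over [Y] divided by [mu Y]. On [Y] the induced process is exchanged
    for the original one, and decorrelation then removes the restriction to [Y]. *)
Lemma mean_rare_event :
  (\int[mu]_x Phi (N n x) - \int[induced_measure mu mY]_x Phi (NY n x))
    @[n --> \oo] --> 0.
Proof.
set a := fine (mu Y); have a0 : 0 < a by exact: fine_gt0_measure.
have bN n := rare_event_bounded mu f n mf.
have bNY n := rare_event_bounded (induced_measure mu mY) _ n
  (measurable_first_return_map f mf Y mY).
have bY : bounded_measurable (\1_Y : T -> R) by exact: bounded_measurable_indic.
have decor := mean_decorrelation mu f mf f_inv f_erg (fun n x => Phi (N n x)) M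
  bN (fun n x => PhiM _) rare_event_shift Y mY.
have b1 n : bounded_measurable (fun x => \1_Y x * Phi (N n x)).
  exact: bounded_measurableM bY (bN n).
have b2 n : bounded_measurable (fun x => \1_Y x * Phi (NY n x)).
  exact: bounded_measurableM bY (bNY n).
have b3 n : bounded_measurable (fun x => `|Phi (N n x) - Phi (NY n x)|).
  by apply: bounded_measurable_norm; exact: bounded_measurableB (bN n) (bNY n).
have diff : (\int[mu]_x (\1_Y x * Phi (N n x)) - \int[mu]_x (\1_Y x * Phi (NY n x)))
    @[n --> \oo] --> 0.
  apply/cvgr0Pnorm_le => eps eps0.
  move/cvgr0Pnorm_le : rare_event_induced => /(_ _ eps0); apply: filterS => n.
  apply: le_trans; rewrite -(meanB mu _ _ (b1 n) (b2 n)).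
  have b12 := bounded_measurableB _ _ (b1 n) (b2 n).
  apply: le_trans (le_norm_mean mu _ b12) _; apply: le_trans (ler_norm _).
  apply: le_mean.
  - exact: bounded_measurable_norm.
  - exact: bounded_measurableM.
  by move=> x; rewrite -mulrBr normrM ger0_norm.
have -> : (fun n => \int[mu]_x Phi (N n x) -
    \int[induced_measure mu mY]_x Phi (NY n x)) =
  (fun n => a^-1 * ((\int[mu]_x (\1_Y x * Phi (N n x)) -
     \int[mu]_x (\1_Y x * Phi (NY n x))) -
     (\int[mu]_x (\1_Y x * Phi (N n x)) - a * \int[mu]_x Phi (N n x)))).
  apply/funext => n; rewrite (mean_induced mu Y mY Y0 _ (bNY n)) -/a.
  by field; rewrite gt_eqF.
have : (a^-1 * ((\int[mu]_x (\1_Y x * Phi (N n x)) -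
     \int[mu]_x (\1_Y x * Phi (NY n x))) -
     (\int[mu]_x (\1_Y x * Phi (N n x)) - a * \int[mu]_x Phi (N n x))))
     @[n --> \oo] --> (a^-1 * (0 - 0) : R).
  by apply: cvgM; [exact: cvg_cst|apply: cvgB].
by rewrite subrr mulr0.
Qed.

End RareEvents.

(** * Transfer of the limit from the induced to the original system *)

Theorem theorem3 (R : realType) (d : measure_display)
    (X : measurableMetricType d R)
    (borelX : @measurable d X = <<s [set U : set X | open U] >>)
    (f : X -> X) (f_meas : measurable_fun [set: X] f)
    (mu : probability X R)
    (f_inv : invariant_measure mu f) (f_erg : ergodic mu f)
    (Y : set X) (mY : measurable Y) (Y_gt0 : (0 < mu Y)%E)
    (phi : X -> \bar R) (zeta : X) (phi_obs : observable phi zeta)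
    (u : nat -> R) (tau : R) (tau_gt0 : 0 < tau)
    (u_lim : (fun n => n%:R%:E * mu [set x | (u n)%:E < phi x])%E @ \oo
             --> tau%:E)
    (U_sub_Y : \forall n \near \oo, [set x | ((u n)%:E < phi x)%E] `<=` Y)
    (dO : measure_display) (Omega : measurableType dO) (P : probability Omega R)
    (N : Omega -> counting_measure R) (N_pp : point_process N)
    (N_cont : forall J : set R, interval_ring J ->
      forall (l : nat) (I : 'I_l -> set R),
      (forall j, interval_semiring (I j)) -> J = \bigcup_j I j ->
      exists2 eta0 : R, 0 < eta0 &
        forall k : 'I_l -> nat, (forall j, (0 < k j)%N) ->
        {within `[0, eta0[%classic, continuous (fun eta : R =>
          P [set w | forall j, ((k j)%:R%:E <= N w (thicken eta (I j)))%E])}) :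
  cvg_in_law (induced_measure mu mY)
    (fun n => rare_event_process (induced_measure mu mY)
                (first_return_map f Y) phi (u n))
    P N ->
  cvg_in_law mu (fun n => rare_event_process mu f phi (u n)) P N.
Proof.
have mphi := observable_measurable phi_obs.
have mU n := measurable_exceedance_set phi mphi u n.
pose p n := fine (mu (exceedance_set phi u n)).
have np : n%:R * p n @[n --> \oo] --> tau.
  have -> : (fun n => n%:R * p n) =
      (fun n => fine (n%:R%:E * mu (exceedance_set phi u n))%E).
    by apply/funext => n; rewrite fineM ?fin_num_measure.
  exact: fine_cvg u_lim.
have p_gt0 : \forall n \near \oo, 0 < p n.
  near=> n; have n0 : 0 < n%:R :> R by rewrite ltr0n; near: n; exact: nbhs_infty_gt.
  by rewrite -(pmulr_rgt0 _ n0); near: n; apply: (cvgr_gt tau).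
have p0 : p n @[n --> \oo] --> 0.
  (* Dividing [n * p n] by [n] recovers [p n] except at index 0, which the shift avoids. *)
  have : (n.+1%:R * p n.+1) * n.+1%:R^-1 @[n --> \oo] --> (tau * 0 : R).
    apply: cvgM; last exact: cvg_harmonic.
    by move: np; rewrite -(cvg_shiftS (fun n => n%:R * p n)).
  rewrite mulr0; under eq_fun do rewrite mulrAC mulfV ?pnatr_eq0// mul1r.
  by rewrite (cvg_shiftS p).
move=> NY_cvg Phi cPhi [M PhiM].
have mF := measurable_first_return_map f f_meas Y mY.
have lawE n : (\int[law mu (rare_event_process mu f phi (u n))]_z (Phi z)%:E =
    (\int[mu]_x Phi (rare_event_process mu f phi (u n) x))%:E)%E.
  have pp := rare_event_point_process phi mphi u mu _ n f_meas.
  exact: (integral_law _ _ _ _ pp cPhi PhiM).1.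
have lawYE n : (\int[law (induced_measure mu mY)
    (rare_event_process (induced_measure mu mY) (first_return_map f Y) phi (u n))]_z
      (Phi z)%:E = (\int[induced_measure mu mY]_x
    Phi (rare_event_process (induced_measure mu mY)
      (first_return_map f Y) phi (u n) x))%:E)%E.
  have pp := rare_event_point_process phi mphi u (induced_measure mu mY) _ n mF.
  exact: (integral_law _ _ _ _ pp cPhi PhiM).1.
have diff := mean_rare_event mu f f_meas f_inv f_erg phi mphi u p0 p_gt0 Phi M cPhi PhiM
  Y mY Y_gt0 U_sub_Y.
pose EY n := \int[induced_measure mu mY]_x
    Phi (rare_event_process (induced_measure mu mY) (first_return_map f Y) phi (u n) x).
pose E n := \int[mu]_x Phi (rare_event_process mu f phi (u n) x).
have limY : (EY n)%:E @[n --> \oo] --> (\int[law P N]_z (Phi z)%:E)%E.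
  apply: cvg_trans (NY_cvg Phi cPhi (ex_intro _ M PhiM)).
  by apply: near_eq_cvg; apply: nearW => n; exact: lawYE.
rewrite -[X in _ --> X]adde0.
apply: (@cvg_trans _ ((fun n => ((EY n)%:E + (E n - EY n)%:E)%E) @ \oo)).
  by apply: near_eq_cvg; apply: nearW => n; rewrite lawE -EFinD addrC subrK.
(* The sum of the two limits is defined because the second, 0, is finite. *)
apply: cvgeD => //; first by rewrite fin_num_adde_defl.
by apply: cvg_EFin; [exact: nearW|exact: diff].
Unshelve. all: by end_near. Qed.
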